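(* Let $A$ be a finite-dimensional formally real Jordan algebra with unit $u$ and rank $r$, and $T_u=\{w\in A:\mathrm{tr}\,w=0\}$ with the variation norm $|w|_u=\max\sigma(w)-\min\sigma(w)$. The horofunctions of $(T_u,|\cdot|_u)$ (basepoint $0$) are precisely the functions $g\colon T_u\to\mathbb{R}$ of the form $$g(v)=\Lambda_{A(p_I)}\Big(-U_{p_I}v-\sum_{i\in I}\alpha_ip_i\Big)+\Lambda_{A(p_J)}\Big(U_{p_J}v-\sum_{j\in J}\alpha_jp_j\Big),$$ where $p_1,\dots,p_r$ is a Jordan frame, $I,J\subseteq\{1,\dots,r\}$ are disjoint and nonempty, $p_I=\sum_{i\in I}p_i$, $p_J=\sum_{j\in J}p_j$, and $\alpha\in\mathbb{R}^{I\cup J}$ with $\min_{i\in I}\alpha_i=0=\min_{j\in J}\alpha_j$. Each horofunction is a Busemann point.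
   Context: $A$: finite-dimensional real vector space with commutative bilinear product $\bullet$ satisfying $x^2\bullet(x\bullet y)=x\bullet(x^2\bullet y)$, formally real, unit $u$; $x\le y$ iff $y-x\in\{a^2:a\in A\}$. Spectral decomposition $x=\sum_{i=1}^r\lambda_ip_i$ over a Jordan frame (mutually orthogonal primitive idempotents summing to $u$); $\sigma(x)=\{\lambda_i\}$, $\mathrm{tr}\,x=\sum\lambda_i$. $U_pv=2p\bullet(p\bullet v)-p^2\bullet v$, $A(p)=U_p(A)$, $\Lambda_{A(p)}(z)=\inf\{\lambda:z\le\lambda p\}$ for $z\in A(p)$. For $w\in T_u$, $g_w(v)=|v-w|_u-|w|_u$; horofunctions are points of the pointwise closure of $\{g_w\}$ in $\mathbb{R}^{T_u}$ not of the form $g_w$. An almost geodesic is a path $\gamma\colon T\to T_u$, $T\subseteq[0,\infty)$ unbounded, $0\in T$, such that for every $\varepsilon>0$ there is $N$ with $\big||\gamma(t)-\gamma(s)|_u+|\gamma(s)-\gamma(0)|_u-t\big|<\varepsilon$ for $t\ge s\ge N$; a Busemann point is a horofunction that is the limit of $g_{\gamma(t)}$ along an almost geodesic. *)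

(* Defs.v *)
From HB Require Import structures.
From mathcomp Require Import all_boot all_order all_algebra.
From mathcomp Require Import classical_sets reals.
Set Implicit Arguments. Unset Strict Implicit. Unset Printing Implicit Defensive.
Import Order.TTheory GRing.Theory Num.Theory.
Local Open Scope ring_scope.
Local Open Scope classical_set_scope.

Section JordanDefs.
Variables (R : realType) (A : vectType R) (mul : A -> A -> A) (u : A).

Definition formally_real_jordan : Prop :=
  [/\ (forall (a : R) (x y z : A), mul (a *: x + y) z = a *: mul x z + mul y z),
      (forall x y, mul x y = mul y x),
      (forall x y, mul (mul x x) (mul x y) = mul x (mul (mul x x) y)),
      (forall s : seq A, \sum_(x <- s) mul x x = 0 -> forall x, x \in s -> x = 0)
    & (forall x, mul u x = x)].

Definition idempotent (p : A) : Prop := mul p p = p.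

Definition primitive_idempotent (p : A) : Prop :=
  [/\ idempotent p, p <> 0 &
      forall q1 q2, idempotent q1 -> idempotent q2 -> mul q1 q2 = 0 ->
        q1 <> 0 -> q2 <> 0 -> p <> q1 + q2].

Definition jordan_frame (n : nat) (p : 'I_n -> A) : Prop :=
  [/\ forall i, primitive_idempotent (p i),
      forall i j, i != j -> mul (p i) (p j) = 0
    & \sum_(i < n) p i = u].

Definition spectral_dec (x : A) (n : nat) (p : 'I_n -> A) (lam : 'I_n -> R) : Prop :=
  jordan_frame p /\ x = \sum_(i < n) lam i *: p i.

Definition spectrum (x : A) : set R :=
  [set l | exists n (p : 'I_n -> A) (lam : 'I_n -> R),
     spectral_dec x p lam /\ exists i, lam i = l].

(* tr x = sum_i lam_i (the set below is a singleton, so sup picks its element) *)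
Definition jtrace (x : A) : R :=
  sup [set t | exists n (p : 'I_n -> A) (lam : 'I_n -> R),
     spectral_dec x p lam /\ t = \sum_(i < n) lam i].

Definition Tu (w : A) : Prop := jtrace w = 0.

Definition varnorm (w : A) : R := sup (spectrum w) - inf (spectrum w).

Definition jle (x y : A) : Prop := exists a, y - x = mul a a.

Definition Uop (p v : A) : A := (mul p (mul p v)) *+ 2 - mul (mul p p) v.

(* Lambda_{A(p)}(z) = inf {lambda : z <= lambda p}, used for z in A(p) = U_p(A) *)
Definition Lam (p z : A) : R := inf [set l | jle z (l *: p)].

Definition gw (w v : A) : R := varnorm (v - w) - varnorm w.

(* g : T_u -> R (represented by its values on T_u) lies in the pointwise
   (product-topology) closure of {g_w : w in T_u} in R^{T_u} *)
Definition in_pointwise_closure (g : A -> R) : Prop :=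
  forall (F : seq A), (forall v, v \in F -> Tu v) ->
  forall eps : R, 0 < eps ->
  exists w, Tu w /\ forall v, v \in F -> `|gw w v - g v| < eps.

Definition horofunction (g : A -> R) : Prop :=
  in_pointwise_closure g /\ ~ (exists w, Tu w /\ forall v, Tu v -> g v = gw w v).

Definition almost_geodesic (T : set R) (gamma : R -> A) : Prop :=
  [/\ (forall t, T t -> 0 <= t), T 0,
      (forall M : R, exists t, T t /\ M <= t),
      (forall t, T t -> Tu (gamma t)) &
      forall eps : R, 0 < eps -> exists N : R, forall t s, T t -> T s -> N <= s -> s <= t ->
        `|varnorm (gamma t - gamma s) + varnorm (gamma s - gamma 0) - t| < eps].

Definition busemann_point (g : A -> R) : Prop :=
  horofunction g /\
  exists (T : set R) (gamma : R -> A), almost_geodesic T gamma /\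
    forall v, Tu v -> forall eps : R, 0 < eps -> exists N : R,
      forall t, T t -> N <= t -> `|gw (gamma t) v - g v| < eps.

End JordanDefs.

(* Main.v *)
Require Import Defs.
From HB Require Import structures.
From mathcomp Require Import boolp classical_sets reals filter topology normedtype.
From mathcomp Require Import all_boot all_order all_algebra.
From mathcomp Require Import complex ring lra.
Set Implicit Arguments. Unset Strict Implicit. Unset Printing Implicit Defensive.
Import Order.TTheory GRing.Theory Num.Theory.
Import numFieldNormedType.Exports.
Import finset VectorInternalTheory.
Local Open Scope ring_scope.

(** Linearizing the Jordan identity shows that [<x, y> = Tr L(xy)] is an associative
    bilinear form and that powers associate; since the algebra is formally real,
    the annihilating polynomial of an element may be taken to split with simple
    roots, so Lagrange interpolation diagonalizes the element.  The form is then
    positive definite and the cone of squares is self-dual: [x >= 0] iff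
    [<x, c> >= 0] for every idempotent [c].

    For [w = sum lam_i p_i] the function [g_w] is a sum of two terms
    [lmax (v - sum al_i p_i)], with [al_i = lam_i - min lam] for [v] and
    [al_i = max lam - lam_i] for [- v].  By self-duality the Peirce component
    [v_{1/2}] of [v] relative to [p_J] satisfies
    [v_{1/2} <= K (d p_J + d^-1 (u - p_J))] for every [d > 0]; hence, as soon as
    [al_i] is large off [J], such a term is within [K d] of the functional of the
    face [A(p_J)], uniformly in the frame.  Along an ultrafilter on [T_u] the
    frames converge and each [al_i] converges or tends to infinity, which yields
    the list of horofunctions; conversely, moving the eigenvalues of a fixed
    frame linearly gives a geodesic ray converging to any prescribed one. *)

(** * Jordan identities and the trace form *)

(* Reduces an identity in [A] to one between real numbers, where [lra] applies. *)
Lemma vec_ext (R : fieldType) (A : vectType R) (x y : A) :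
  (forall f : A -> R, (forall a b, f (a + b) = f a + f b) ->
     (forall k a, f (k *: a) = k * f a) -> (forall a, f (- a) = - f a) ->
     f 0 = 0 -> f x = f y) -> x = y.
Proof.
move=> H; apply: (can_inj v2rK); apply/rowP => i.
by apply: (H (fun a => v2r a 0 i)) => [a b|k a|a|];
  rewrite ?linearD ?linearZ ?linearN ?linear0 !mxE.
Qed.

Section JordanIdentities.
Variables (R : realType) (A : vectType R) (mul : A -> A -> A) (u : A).
Hypothesis HA : formally_real_jordan mul u.
Local Notation "x ** y" := (mul x y) (at level 40, left associativity).
Implicit Types (x y z w : A) (a b : R).

Lemma jmulC x y : x ** y = y ** x.
Proof. by case: HA => _ H _ _ _; apply: H. Qed.
Lemma jmul1l x : u ** x = x.
Proof. by case: HA => _ _ _ _ H; apply: H. Qed.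
Lemma jmul1r x : x ** u = x.
Proof. by rewrite jmulC jmul1l. Qed.
Lemma jmul0l z : 0 ** z = 0.
Proof.
have [H _ _ _ _] := HA; have := H 1 0 0 z.
by rewrite !scale1r addr0 => /(congr1 (fun t => t - 0 ** z)); rewrite addrK subrr.
Qed.
Lemma jmulDl x y z : (x + y) ** z = x ** z + y ** z.
Proof. by have [H _ _ _ _] := HA; rewrite -{1}[x]scale1r H scale1r. Qed.
Lemma jmulZl a x z : (a *: x) ** z = a *: (x ** z).
Proof. by have [H _ _ _ _] := HA; rewrite -{1}[_ *: x]addr0 H jmul0l addr0. Qed.
Lemma jmulNl x z : (- x) ** z = - (x ** z).
Proof. by rewrite -scaleN1r jmulZl scaleN1r. Qed.
Lemma jmulBl x y z : (x - y) ** z = x ** z - y ** z.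
Proof. by rewrite jmulDl jmulNl. Qed.
Lemma jmul0r z : z ** 0 = 0. Proof. by rewrite jmulC jmul0l. Qed.
Lemma jmulDr x y z : z ** (x + y) = z ** x + z ** y.
Proof. by rewrite jmulC jmulDl !(jmulC z). Qed.
Lemma jmulZr a x z : z ** (a *: x) = a *: (z ** x).
Proof. by rewrite jmulC jmulZl !(jmulC z). Qed.
Lemma jmulNr x z : z ** (- x) = - (z ** x).
Proof. by rewrite jmulC jmulNl !(jmulC z). Qed.
Lemma jmulBr x y z : z ** (x - y) = z ** x - z ** y.
Proof. by rewrite jmulDr jmulNr. Qed.
Lemma jmul_suml I (r : seq I) (P : pred I) (F : I -> A) z :
  (\sum_(i <- r | P i) F i) ** z = \sum_(i <- r | P i) F i ** z.
Proof.
by elim/big_rec2: _ => [|i s y _ <-]; rewrite ?jmul0l ?jmulDl.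
Qed.
Lemma jmul_sumr I (r : seq I) (P : pred I) (F : I -> A) z :
  z ** (\sum_(i <- r | P i) F i) = \sum_(i <- r | P i) z ** F i.
Proof. by rewrite jmulC jmul_suml; under eq_bigr do rewrite jmulC. Qed.

Definition jmulE := (jmulDl, jmulDr, jmulZl, jmulZr, jmulNl, jmulNr, jmul0l, jmul0r).

(** Polarization: the alternating sum of the Jordan identity over the partial sums of [x], [y], [z]
    leaves only its trilinear part. *)
Lemma jordan_linearized x y z w :
  (x ** y) ** (z ** w) + (y ** z) ** (x ** w) + (z ** x) ** (y ** w) =
  z ** ((x ** y) ** w) + x ** ((y ** z) ** w) + y ** ((z ** x) ** w).
Proof.
have J t : (t ** t) ** (t ** w) = t ** ((t ** t) ** w).
  by have [_ _ H _ _] := HA; apply: H.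
have := (J (x + y + z), J (x + y), J (y + z), J (x + z), J x, J y, J z).
rewrite !(jmulDl, jmulDr) !(jmulC y x) !(jmulC z x) !(jmulC z y).
case=> [[[[[[H1 H2] H3] H4] H5] H6] H7].
apply: vec_ext => f fD fZ fN f0.
move: (congr1 f H1) (congr1 f H2) (congr1 f H3) (congr1 f H4) (congr1 f H5)
  (congr1 f H6) (congr1 f H7) => {H1 H2 H3 H4 H5 H6 H7 J}.
rewrite !fD; lra.
Qed.

(* The left-hand side of [jordan_linearized] is symmetric in its four arguments,
   so its right-hand side is invariant under exchanging [w] and [y]. *)
Lemma jmul3 x y z w :
  ((x ** y) ** z) ** w = x ** ((y ** z) ** w) + y ** ((x ** z) ** w)
    + z ** ((x ** y) ** w) - x ** (z ** (y ** w)) - y ** (z ** (x ** w)).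
Proof.
have H1 := jordan_linearized x y z w; have H2 := jordan_linearized w x y z.
move: H1 H2; rewrite (jmulC z x) (jmulC w x) (jmulC w z) (jmulC (x ** w) (y ** z)).
rewrite (jmulC w (_ ** z)) (jmulC (x ** w) z) (jmulC (y ** w) z) (jmulC (y ** w) (x ** z)).
move=> H1 H2.
apply: vec_ext => f fD fZ fN f0.
move: (congr1 f H1) (congr1 f H2); rewrite !(fD, fN); lra.
Qed.

(** With L for multiplication operators, the right-hand side is the commutator [L_z, [L_x, L_y]]; it
    is traceless, which makes the trace form associative. *)
Lemma jmul_commutator x y z w :
  ((z ** x) ** y - (z ** y) ** x) ** w =
  z ** (x ** (y ** w) - y ** (x ** w)) - (x ** (y ** (z ** w)) - y ** (x ** (z ** w))).
Proof.
rewrite jmulBl !(jmul3 z) !(jmulC y x) !(jmulE).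
apply: vec_ext => f fD fZ fN f0; rewrite !(fD, fN); lra.
Qed.

Definition jpow x n := iter n (mul x) u.

Lemma jpowS x n : jpow x n.+1 = x ** jpow x n. Proof. by []. Qed.

(** Multiplication by a power is a polynomial in the commuting multiplications by [x] and [x ** x].
    The recursion [H], from [jmul3], involves both operators, so the strong induction carries both
    commutations. *)
Lemma jpow_comm x n w :
  jpow x n ** (x ** w) = x ** (jpow x n ** w) /\
  jpow x n ** ((x ** x) ** w) = (x ** x) ** (jpow x n ** w).
Proof.
have J t : (x ** x) ** (x ** t) = x ** ((x ** x) ** t).
  by have [_ _ H _ _] := HA; apply: H.
elim: n {-2}n (leqnn n) w => [|n IHn] m; first by case: m => // _ w; rewrite !jmul1l.
case: m => [|[|m]] le_mn w; rewrite ?jmul1l //.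
  by rewrite jpowS jmul1r J.
have H t : jpow x m.+2 ** t = jpow x m ** ((x ** x) ** t)
    + 2 *: (x ** (jpow x m.+1 ** t)) - jpow x m ** (x ** (x ** t))
    - x ** (x ** (jpow x m ** t)).
  rewrite !jpowS (jmulC x (x ** _)) {1}(jmulC x) jmul3 !(jmulC _ x).
  by apply: vec_ext => f fD fZ fN f0; rewrite !(fD, fN, fZ); lra.
have C k t : (k <= n)%N -> jpow x k ** (x ** t) = x ** (jpow x k ** t).
  by move=> le_kn; have [] := IHn k le_kn t.
have D k t : (k <= n)%N -> jpow x k ** ((x ** x) ** t) = (x ** x) ** (jpow x k ** t).
  by move=> le_kn; have [] := IHn k le_kn t.
have Cm := C m _ (ltnW le_mn); have Dm := D m _ (ltnW le_mn).
have Cs := C m.+1 _ le_mn; have Ds := D m.+1 _ le_mn.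
by split; rewrite !H !jmulE !(Cm, Dm, Cs, Ds, J).
Qed.

Lemma jpowD x m n : jpow x m ** jpow x n = jpow x (m + n).
Proof.
elim: n => [|n IHn]; first by rewrite jmul1r addn0.
by rewrite jpowS (jpow_comm x m _).1 IHn addnS.
Qed.

(** Matrices act on rows from the right, so a matrix product applies its left factor first. *)
Definition mulmx_of x : 'M[R]_(dim A) := lin1_mx (fun v => v2r (x ** r2v v)).

Lemma mulmx_ofE x y : v2r y *m mulmx_of x = v2r (x ** y).
Proof.
have lf : linear (fun v : 'rV[R]_(dim A) => v2r (x ** r2v v)).
  by move=> k v w; rewrite linearP jmulDr jmulZr linearP.
pose f := GRing.isLinear.Build _ _ _ _ _ lf.
pose F : {linear _ -> _} := HB.pack (fun v : 'rV[R]_(dim A) => v2r (x ** r2v v)) f.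
by rewrite -[mulmx_of x]/(lin1_mx F) mul_rV_lin1 /F /= v2rK.
Qed.

Lemma mulmx_of_ext (M N : 'M[R]_(dim A)) :
  (forall w, v2r w *m M = v2r w *m N) -> M = N.
Proof. by move=> H; apply/row_matrixP => i; rewrite !rowE -[delta_mx _ _]r2vK H. Qed.

Definition tau x : R := \tr (mulmx_of x).
Definition tform x y : R := tau (x ** y).

Lemma tauD x y : tau (x + y) = tau x + tau y.
Proof.
rewrite /tau -mxtraceD; congr mxtrace; apply: mulmx_of_ext => w.
by rewrite mulmxDr !mulmx_ofE jmulDl linearD.
Qed.
Lemma tauZ a x : tau (a *: x) = a * tau x.
Proof.
rewrite /tau -mxtraceZ; congr mxtrace; apply: mulmx_of_ext => w.
by rewrite -scalemxAr !mulmx_ofE jmulZl linearZ.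
Qed.
Lemma tau0 : tau 0 = 0. Proof. by rewrite -[0](scale0r 0) tauZ mul0r. Qed.
Lemma tauN x : tau (- x) = - tau x. Proof. by rewrite -scaleN1r tauZ mulN1r. Qed.

Lemma tau_assoc x y z : tau ((z ** x) ** y) = tau ((z ** y) ** x).
Proof.
apply/eqP; rewrite -subr_eq0 -tauN -tauD; apply/eqP.
pose Mx := mulmx_of x; pose My := mulmx_of y; pose Mz := mulmx_of z.
rewrite /tau (_ : mulmx_of _ = (My *m Mx - Mx *m My) *m Mz
   - Mz *m (My *m Mx - Mx *m My)); last first.
  apply: mulmx_of_ext => w; rewrite mulmx_ofE jmul_commutator.
  rewrite mulmxBr !mulmxA !(mulmxBr, mulmxBl) !mulmxA !mulmx_ofE.
  by rewrite !linearB /= jmulBr !linearB.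
by rewrite mxtraceD raddfN /= [\tr (_ *m Mz)]mxtrace_mulC subrr.
Qed.

Lemma tformC x y : tform x y = tform y x. Proof. by rewrite /tform jmulC. Qed.
Lemma tformDl x y z : tform (x + y) z = tform x z + tform y z.
Proof. by rewrite /tform jmulDl tauD. Qed.
Lemma tformZl a x z : tform (a *: x) z = a * tform x z.
Proof. by rewrite /tform jmulZl tauZ. Qed.
Lemma tformNl x z : tform (- x) z = - tform x z.
Proof. by rewrite /tform jmulNl tauN. Qed.
Lemma tform0l z : tform 0 z = 0.
Proof. by rewrite /tform jmul0l tau0. Qed.
Lemma tformDr x y z : tform z (x + y) = tform z x + tform z y.
Proof. by rewrite tformC tformDl !(tformC z). Qed.
Lemma tformZr a x z : tform z (a *: x) = a * tform z x.
Proof. by rewrite tformC tformZl !(tformC z). Qed.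
Lemma tformNr x z : tform z (- x) = - tform z x.
Proof. by rewrite tformC tformNl !(tformC z). Qed.
Lemma tform0r z : tform z 0 = 0.
Proof. by rewrite tformC tform0l. Qed.
Definition tformE := (tformDl, tformDr, tformZl, tformZr, tformNl, tformNr, tform0l, tform0r).
Lemma tform_suml I (r : seq I) (P : pred I) (F : I -> A) z :
  tform (\sum_(i <- r | P i) F i) z = \sum_(i <- r | P i) tform (F i) z.
Proof. by elim/big_rec2: _ => [|i s y _ <-]; rewrite ?tform0l ?tformDl. Qed.
Lemma tform_sumr I (r : seq I) (P : pred I) (F : I -> A) z :
  tform z (\sum_(i <- r | P i) F i) = \sum_(i <- r | P i) tform z (F i).
Proof. by rewrite tformC tform_suml; under eq_bigr do rewrite tformC. Qed.

Lemma tform_assoc x y z : tform (x ** y) z = tform x (y ** z).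
Proof. by rewrite /tform (jmulC x y) tau_assoc jmulC. Qed.
Lemma tformu x : tform u x = tau x. Proof. by rewrite /tform jmul1l. Qed.

End JordanIdentities.

(** * Spectral theorem and Peirce rules *)

(** There is a complex root a + ib. If b is nonzero, the remainder modulo the real quadratic has
    degree at most one and a non-real root, hence vanishes. *)
Lemma real_poly_factor (R : rcfType) (f : {poly R}) : (1 < size f)%N ->
  (exists a, root f a) \/
  exists a b, b != 0 /\ (('X - a%:P) ^+ 2 + (b ^+ 2)%:P) %| f.
Proof.
move=> sf; pose F := map_poly (real_complex R) f.
have [|z rz] := closed_rootP F _; first by rewrite size_map_poly neq_ltn sf orbT.
case: z rz => a b rz; have [b0|b0] := eqVneq b 0.
  left; exists a; move: rz; rewrite b0 -[Complex a 0]/(real_complex R a).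
  by rewrite fmorph_root.
right; exists a, b; split=> //.
set q := _ + _; have mq : q \is monic.
  rewrite monicE lead_coefDl ?lead_coef_exp ?lead_coefXsubC ?expr1n //.
  by rewrite size_exp_XsubC size_polyC; case: eqP.
have sq : size q = 3%N.
  rewrite size_polyDl size_exp_XsubC // size_polyC; by case: eqP.
have : root F (Complex a b) by [].
rewrite /F {1}(divp_eq f q) rmorphD rmorphM /= rootE hornerD hornerM.
have -> : (map_poly (real_complex R) q).[Complex a b] = 0.
  rewrite /q rmorphD rmorphXn rmorphB /= map_polyX !map_polyC /= !hornerE /=.
  rewrite !expr2; simpc; congr (Complex _ _); ring.
rewrite mulr0 add0r; have : (size (f %% q)%R < 3)%N by rewrite -sq ltn_modp monic_neq0.
rewrite /dvdp; move: (f %% q) => r sr; rewrite (_ : r = (r`_0)%:P + r`_1 *: 'X); last first.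
  apply/polyP => -[|[|i]]; rewrite !coefE /= ?mulr0 ?mulr1 ?addr0 ?add0r //.
  by rewrite nth_default // (leq_trans _ (isT : 2 <= i.+2)%N).
rewrite rmorphD /= map_polyC map_polyZ map_polyX /= !hornerE /=; simpc.
rewrite eq_complex /= mulf_eq0 (negPf b0) orbF => /andP[h /eqP h1].
by move: h; rewrite h1 mul0r addr0 => /eqP ->; rewrite scale0r addr0 polyC0.
Qed.

Section Spectral.
Variables (R : realType) (A : vectType R) (mul : A -> A -> A) (u : A).
Hypothesis HA : formally_real_jordan mul u.
Local Notation "x ** y" := (mul x y) (at level 40, left associativity).
Implicit Types (x y z w e : A) (a b : R) (f g h : {poly R}).

Local Notation pw := (jpow mul u).

Definition ev f x : A := \sum_(i < size f) f`_i *: pw x i.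

Lemma ev_wide n f x : (size f <= n)%N -> ev f x = \sum_(i < n) f`_i *: pw x i.
Proof.
move=> le; rewrite /ev (big_ord_widen n (fun i => f`_i *: pw x i) le) big_mkcond /=.
apply: eq_bigr => i _; case: ltnP => // le'; by rewrite nth_default // scale0r.
Qed.

Lemma evD f g x : ev (f + g) x = ev f x + ev g x.
Proof.
pose n := maxn (size (f + g)%R) (maxn (size f) (size g)).
rewrite !(@ev_wide n) ?leq_max ?leqnn ?orbT // -big_split /=.
by apply: eq_bigr => i _; rewrite coefD scalerDl.
Qed.

Lemma evZ a f x : ev (a *: f) x = a *: ev f x.
Proof.
pose n := maxn (size (a *: f)%R) (size f).
rewrite !(@ev_wide n) ?leq_max ?leqnn ?orbT // scaler_sumr.
by apply: eq_bigr => i _; rewrite coefZ scalerA.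
Qed.

Lemma ev0 x : ev 0 x = 0. Proof. by rewrite -(scale0r 0) evZ scale0r. Qed.
Lemma ev1 x : ev 1 x = u.
Proof. by rewrite (@ev_wide 1) ?size_poly1 // big_ord1 coefC /= scale1r. Qed.
Lemma evXmul f x : ev (f * 'X) x = x ** ev f x.
Proof.
rewrite (@ev_wide (size f).+1); last first.
  by rewrite (leq_trans (size_polyMleq _ _)) // size_polyX addn2.
rewrite big_ord_recl coefMX eqxx scale0r add0r (jmul_sumr HA).
by apply: eq_bigr => i _; rewrite coefMX /= (jmulZr HA).
Qed.
Lemma evX x : ev 'X x = x.
Proof. by rewrite -['X]mul1r evXmul ev1 (jmul1r HA). Qed.

Lemma evM f g x : ev (f * g) x = ev f x ** ev g x.
Proof.
have assoc f1 g1 : x ** (ev f1 x ** ev g1 x) = (x ** ev f1 x) ** ev g1 x.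
  rewrite /ev !(jmul_sumr HA, jmul_suml HA); apply: eq_bigr => i _.
  rewrite !(jmul_suml HA, jmul_sumr HA); apply: eq_bigr => j _.
  by rewrite !(jmulZl HA, jmulZr HA) (jpowD HA) -!jpowS (jpowD HA) addSn !scalerA mulrC.
elim/poly_ind: f => [|f c IHf] in g *; first by rewrite mul0r ev0 (jmul0l HA).
rewrite mulrDl evD mulrAC evXmul IHf assoc -evXmul evD (jmulDl HA); congr (_ + _).
by rewrite mul_polyC evZ -alg_polyC evZ ev1 (jmulZl HA) (jmul1l HA).
Qed.

Lemma sum2_eq0 x y : x ** x + y ** y = 0 -> x = 0 /\ y = 0.
Proof.
move=> xy0; have [_ _ _ H _] := HA.
by split; apply: (H [:: x; y]); rewrite ?big_cons ?big_nil ?addr0 // !inE eqxx ?orbT.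
Qed.

Lemma sqr_eq0 x : x ** x = 0 -> x = 0.
Proof. by move=> x0; have [] := @sum2_eq0 x x; rewrite ?x0 ?addr0. Qed.

Lemma annihilator_exists x : exists2 f, f != 0 & ev f x = 0.
Proof.
pose X := [tuple pw x i | i < (dim A).+1].
have nfX : ~~ free X.
  apply: contraL (dimvS (subvf <<X>>%VS)) => /eqP ->.
  by rewrite size_tuple dimvf -ltnNge.
have /negP nf := nfX; apply: contra_notP nf => nex; apply/freeP => k k0 i.
pose f := \poly_(j < (dim A).+1) k (inord j).
have f0 : f = 0.
  apply: contra_notP nex => /eqP nf; exists f => //.
  rewrite (@ev_wide (dim A).+1) ?size_poly // -[RHS]k0; apply: eq_bigr => j _.
  by rewrite coef_poly ltn_ord inord_val -tnth_nth tnth_mktuple.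
by have := congr1 (fun g => g`_i) f0; rewrite coef_poly ltn_ord inord_val coef0.
Qed.

(** Induction on the size of the cofactor [f] still to be split, [s] being the distinct roots
    already extracted. *)
Lemma split_annihilator x :
  exists2 s : seq R, uniq s & ev (\prod_(a <- s) ('X - a%:P)) x = 0.
Proof.
have [f f0 fx] := annihilator_exists x.
suff H n : forall f s, (size f <= n)%N -> f != 0 -> uniq s ->
    ev (f * \prod_(a <- s) ('X - a%:P)) x = 0 ->
    exists2 s : seq R, uniq s & ev (\prod_(a <- s) ('X - a%:P)) x = 0.
  by apply: (H (size f) f [::]); rewrite ?big_nil ?mulr1.
elim: n => [|n IHn] {fx}f s sf {}f0 us fx.
  by move: f0; rewrite -size_poly_gt0; case: (size f) sf.
have [sf1|sf1] := leqP (size f) 1.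
  exists s => //; move: fx f0; rewrite (size1_polyC sf1) mul_polyC evZ polyC_eq0.
  by move=> /eqP; rewrite scaler_eq0 => /orP[->|/eqP].
have [[a /factor_theorem[g fE]]|[a [b [b0 /dvdpP[g fE]]]]] := real_poly_factor sf1.
- have g0 : g != 0 by apply: contraNneq f0 => g0; rewrite fE g0 mul0r.
  have sg : (size g <= n)%N.
    by move: sf; rewrite fE size_mul ?polyXsubC_eq0 // size_XsubC addn2.
  have [as_|nas] := boolP (a \in s); last first.
    apply: (IHn g (a :: s)) => //=; first by rewrite nas.
    by rewrite big_cons mulrA -fE.
  (* A root already in [s] is dropped: the square of the shorter product is a multiple of the
     annihilating one, and a vanishing square forces zero. *)
  apply: (IHn g s) => //; apply: sqr_eq0; rewrite -evM.
  have -> : g * \prod_(a <- s) ('X - a%:P) * (g * \prod_(a <- s) ('X - a%:P)) =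
      (f * \prod_(a <- s) ('X - a%:P)) * (g * \prod_(b <- rem a s) ('X - b%:P)).
    rewrite fE (perm_big _ (perm_to_rem as_)) big_cons /=; ring.
  by rewrite evM fx (jmul0l HA).
- have g0 : g != 0 by apply: contraNneq f0 => g0; rewrite fE g0 mul0r.
  set q := _ + _ in fE; have sq : size q = 3%N.
    rewrite size_polyDl size_exp_XsubC // size_polyC; by case: eqP.
  have q0 : q != 0 by rewrite -size_poly_gt0 sq.
  have sg : (size g <= n)%N.
    by move: sf; rewrite fE size_mul // sq addn3 /= => /ltnW.
  apply: (IHn g s) => //; set G := g * _.
  (* A quadratic factor is dropped: these two squares sum to a multiple of the annihilator, so
     formal reality kills both, and [b] is nonzero. *)
  have : ev (('X - a%:P) * G) x ** ev (('X - a%:P) * G) x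
      + ev (b *: G) x ** ev (b *: G) x = 0.
    rewrite -!evM -evD.
    have -> : ('X - a%:P) * G * (('X - a%:P) * G) + b *: G * (b *: G) =
       (f * \prod_(a <- s) ('X - a%:P)) * G.
      rewrite -!mul_polyC fE /G /q polyC_exp; ring.
    by rewrite evM fx (jmul0l HA).
  move=> /sum2_eq0[_ /eqP]; rewrite evZ scaler_eq0 (negPf b0) => /eqP //.
Qed.

(** Unlike in a Jordan frame, members may vanish or fail to be primitive. *)
Definition orth_system (n : nat) (c : 'I_n -> A) : Prop :=
  [/\ forall i, c i ** c i = c i, forall i j, i != j -> c i ** c j = 0
    & \sum_(i < n) c i = u].

(** The [c i] are the Lagrange polynomials at the roots of a split annihilator, evaluated at [x].
    Their being polynomials in [x] is what [spectral_A1] uses to keep them in a Peirce space. *)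
Lemma spectral_poly x : exists n (a : 'I_n -> R) (c : 'I_n -> A),
  [/\ orth_system c, x = \sum_(i < n) a i *: c i
    & forall i, exists f, c i = ev f x].
Proof.
have [s us sx] := split_annihilator x.
have ann h : (forall a, a \in s -> h.[a] = 0) -> ev h x = 0.
  move=> h0; have : \prod_(a <- s) ('X - a%:P) %| h.
    apply: uniq_roots_dvdp; last by rewrite uniq_rootsE.
    by apply/allP => a /h0 /eqP.
  by move=> /dvdpP[g ->]; rewrite evM sx (jmul0r HA).
pose n := size s; pose a (i : 'I_n) := s`_i.
have ainj i j : a i = a j -> i = j.
  by move=> /eqP; rewrite nth_uniq // => /eqP/val_inj.
pose l (i : 'I_n) := \prod_(j < n | j != i) ((a i - a j)^-1 *: ('X - (a j)%:P)).
have lE i k : (l i).[a k] = (i == k)%:R.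
  rewrite horner_prod; case: eqP => [<-|/eqP ik].
    apply: big1 => j ji; rewrite !hornerE mulVf // subr_eq0.
    by apply: contraNneq ji => /ainj ->.
  by rewrite (bigD1 k) 1?eq_sym //= !hornerE subrr mulr0 mul0r.
have ann' h : (forall k, h.[a k] = 0) -> ev h x = 0.
  move=> h0; apply: ann => b bs.
  have lt : (index b s < n)%N by rewrite index_mem.
  by have := h0 (Ordinal lt); rewrite /a /= nth_index.
have evsum I (r : seq I) (F : I -> {poly R}) :
    ev (\sum_(i <- r) F i) x = \sum_(i <- r) ev (F i) x.
  by elim/big_rec2: _ => [|i y1 y2 _ <-]; rewrite ?ev0 ?evD.
have eqev f g : (forall k, f.[a k] = g.[a k]) -> ev f x = ev g x.
  move=> fg; apply/eqP; rewrite -subr_eq0 -scaleN1r -evZ -evD; apply/eqP/ann' => k.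
  by rewrite hornerD hornerZ fg mulN1r subrr.
exists n, a, (fun i => ev (l i) x); split; last by move=> i; exists (l i).
- split=> [i|i j ij|].
  + rewrite -evM; apply: eqev => k; rewrite hornerM !lE; by case: eqP => _; rewrite ?mulr1 ?mulr0.
  + rewrite -evM; apply: ann' => k; rewrite hornerM !lE.
    by case: eqP => [<-|_]; rewrite ?mul0r // eq_sym (negPf ij) mulr0.
  + rewrite -evsum -[RHS](ev1 x); apply: eqev => k; rewrite horner_sum hornerC.
    rewrite (bigD1 k) //= lE eqxx big1 ?addr0 // => i ik; by rewrite lE (negPf ik).
- under eq_bigr do rewrite -evZ.
  rewrite -evsum -{1}(evX x); apply: eqev => k; rewrite horner_sum hornerX.
  rewrite (bigD1 k) //= hornerZ lE eqxx mulr1 big1 ?addr0 // => i ik.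
  by rewrite hornerZ lE (negPf ik) mulr0.
Qed.

(** Multiplication by an idempotent thus has eigenvalues among 0, 1/2 and 1, the source of the
    Peirce decomposition. *)
Lemma peirce_cubic e y : e ** e = e ->
  2 *: (e ** (e ** (e ** y))) = 3 *: (e ** (e ** y)) - e ** y.
Proof.
move=> ee; have := jordan_linearized HA e e y e.
rewrite !ee !(jmulC HA y) !(jmulC HA (e ** y)) => H.
apply: vec_ext => f fD fZ fN f0; move: (congr1 f H).
by rewrite ?(jmulC HA (e ** (e ** y))) !(fD, fN, fZ); lra.
Qed.

(* Multiplication by [e] commutes with multiplication by an element of [A_0(e)]
   or [A_1(e)], since then [2k - 1 <> 0]. *)
Lemma peirce_comm e z w k : e ** e = e -> 2 * k - 1 != 0 -> e ** z = k *: z ->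
  e ** (z ** w) = z ** (e ** w).
Proof.
move=> ee k0 ez; have := jordan_linearized HA e e z w.
rewrite !ee (jmulC HA z e) !ez !(jmulE HA) => H; apply: vec_ext => f fD fZ fN f0.
move: (congr1 f H); rewrite !(fD, fN, fZ) => {}H; apply: (mulfI k0).
lra.
Qed.

Lemma peirce11 e z w : e ** e = e -> e ** z = z -> e ** w = w -> e ** (z ** w) = z ** w.
Proof.
move=> ee ez ew; rewrite (@peirce_comm _ _ _ 1) ?ew ?scale1r //.
by rewrite mulr1 (_ : 2 - 1 = 1 :> R) ?oner_eq0 //; lra.
Qed.

(** [peirce_comm] for [z] puts the product in the eigenspace 0 of [e], and for [w] in the eigenspace
    1. *)
Lemma peirce10 e z w : e ** e = e -> e ** z = z -> e ** w = 0 -> z ** w = 0.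
Proof.
move=> ee ez ew.
have H1 : e ** (z ** w) = 0.
  rewrite (@peirce_comm _ _ _ 1) ?ew ?(jmul0r HA) ?scale1r //.
  by rewrite mulr1 (_ : 2 - 1 = 1 :> R) ?oner_eq0 //; lra.
rewrite -H1 (jmulC HA z) (@peirce_comm _ _ _ 0) ?scale0r //.
  by rewrite ez.
by rewrite mulr0 add0r oppr_eq0 oner_eq0.
Qed.

(** The factor ['X] removes the constant term, a multiple of [u], which [e] in general does not
    fix. *)
Lemma peirce1_ev e z f : e ** e = e -> e ** z = z -> e ** ev (f * 'X) z = ev (f * 'X) z.
Proof.
move=> ee ez; elim/poly_ind: f => [|f c IHf]; first by rewrite mul0r ev0 (jmul0r HA).
rewrite mulrDl evD (jmulDr HA) mul_polyC evZ evX (jmulZr HA) ez evXmul.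
by rewrite peirce11.
Qed.

End Spectral.

(** * The cone of squares *)

(** In a rank factorization E = CR, idempotence forces RC = 1, and the trace is cyclic. *)
Lemma mxtrace_idempotent (F : fieldType) n (E : 'M[F]_n) :
  E *m E = E -> \tr E = (\rank E)%:R.
Proof.
move=> EE; have: row_base E *m col_base E = 1%:M.
  have /row_freeP[B EB] := row_base_free E.
  have /row_fullP[C CE] := col_base_full E.
  have : (col_base E *m row_base E) *m (col_base E *m row_base E)
      = col_base E *m row_base E by rewrite !mulmx_base.
  move: EB CE.
  move: (row_base E) (col_base E) => X Y EB CE.
  rewrite !mulmxA => /(congr1 (fun Z => C *m Z *m B)) /=.
  by rewrite -!mulmxA EB !mulmx1 !mulmxA CE !mul1mx.
have -> : \tr E = \tr (row_base E *m col_base E) by rewrite mxtrace_mulC mulmx_base.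
by move=> ->; rewrite mxtrace1.
Qed.

Section Cone.
Variables (R : realType) (A : vectType R) (mul : A -> A -> A) (u : A).
Hypothesis HA : formally_real_jordan mul u.
Local Notation "x ** y" := (mul x y) (at level 40, left associativity).
Implicit Types (x y z v w c p e : A) (a b k : R).
Local Notation B := (tform mul).
Local Notation tau := (tau mul).
Local Notation U := (Uop mul).
Local Notation idem := (Defs.idempotent mul).

(* The projection on the Peirce space [A_{1/2}(p)]. *)
Definition Uhalf p v : A := 4 *: (p ** v) - 4 *: (p ** (p ** v)).

Lemma UopE p v : idem p -> U p v = 2 *: (p ** (p ** v)) - p ** v.
Proof. by move=> pp; rewrite /Uop pp scaler_nat. Qed.

Lemma jmulLLL p v : idem p ->
  p ** (p ** (p ** v)) = (3 / 2) *: (p ** (p ** v)) - (1 / 2) *: (p ** v).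
Proof.
move=> pp; have H := peirce_cubic HA v pp; apply: vec_ext => f fD fZ fN f0.
move: (congr1 f H); rewrite !(fD, fN, fZ); lra.
Qed.

Lemma jmul_Uop p v : idem p -> p ** U p v = U p v.
Proof.
move=> pp; rewrite !UopE // !(jmulE HA) jmulLLL //.
by apply: vec_ext => f fD fZ fN f0; rewrite !(fD, fN, fZ); lra.
Qed.

Lemma Uop_id p v : idem p -> p ** v = v -> U p v = v.
Proof.
move=> pp pv; rewrite UopE // !pv.
by apply: vec_ext => f fD fZ fN f0; rewrite !(fD, fN, fZ); lra.
Qed.

Lemma Uop_orth p v : idem p -> p ** v = 0 -> U p v = 0.
Proof. by move=> pp pv; rewrite UopE // !pv (jmul0r HA) scaler0 subr0. Qed.

Lemma UopD p v w : U p (v + w) = U p v + U p w.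
Proof. by rewrite /Uop !(jmulE HA) mulrnDl opprD addrACA. Qed.
Lemma UopN p v : U p (- v) = - U p v.
Proof. by rewrite /Uop !(jmulE HA) mulNrn [RHS]opprD. Qed.
Lemma UopB p v w : U p (v - w) = U p v - U p w.
Proof. by rewrite UopD UopN. Qed.
Lemma UopZ p k v : U p (k *: v) = k *: U p v.
Proof. by rewrite /Uop !(jmulE HA) scalerBr scalerMnr. Qed.

Lemma Uhalf_id p v : idem p -> Uhalf p (Uhalf p v) = Uhalf p v.
Proof.
move=> pp; rewrite /Uhalf !(jmulE HA) !jmulLLL // !(jmulE HA) !jmulLLL //.
by apply: vec_ext => f fD fZ fN f0; rewrite !(fD, fN, fZ); lra.
Qed.

Lemma tformL p x y : B (p ** x) y = B x (p ** y).
Proof. by rewrite (jmulC HA) (tform_assoc HA). Qed.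

Lemma tform_Uop p x y : idem p -> B (U p x) y = B x (U p y).
Proof. by move=> pp; rewrite !UopE // !(tformE HA) !tformL. Qed.
Lemma tform_Uhalf p x y : B (Uhalf p x) y = B x (Uhalf p y).
Proof. by rewrite /Uhalf !(tformE HA) !tformL. Qed.

Lemma idem_u : idem u. Proof. exact: (jmul1l HA). Qed.
Lemma idemC p : idem p -> idem (u - p).
Proof.
move=> pp; rewrite /Defs.idempotent !(jmulE HA) pp !(jmul1l HA) (jmul1r HA).
by apply: vec_ext => f fD fZ fN f0; rewrite !(fD, fN); lra.
Qed.

Lemma peirce_decomp p v : idem p -> v = U p v + U (u - p) v + Uhalf p v.
Proof.
move=> pp; rewrite !UopE //; last exact: idemC.
rewrite !(jmulE HA) !(jmul1l HA) /Uhalf.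
by apply: vec_ext => f fD fZ fN f0; rewrite !(fD, fN, fZ); lra.
Qed.

Lemma tform_idem c : idem c -> B c c = tau c. Proof. by rewrite /tform => ->. Qed.

Lemma tform_orth_coef n (c : 'I_n -> A) (a : 'I_n -> R) i : orth_system mul u c ->
  B (\sum_j a j *: c j) (c i) = a i * tau (c i).
Proof.
case=> cc co _; rewrite (tform_suml HA) (bigD1 i) //= (tformZl HA) tform_idem; last exact: cc.
by rewrite big1 ?addr0 // => j ji; rewrite (tformZl HA) /tform co // (tau0 HA) mulr0.
Qed.

Lemma orth_coef n (c : 'I_n -> A) (a : 'I_n -> R) i : orth_system mul u c ->
  c i ** (\sum_j a j *: c j) = a i *: c i.
Proof.
case=> cc co _; rewrite (jmul_sumr HA) (bigD1 i) //= (jmulZr HA) cc.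
by rewrite big1 ?addr0 // => j ji; rewrite (jmulZr HA) co 1?eq_sym // scaler0.
Qed.

(** Multiplication by [c] is [P1] plus half of [Ph], both Peirce projections, so its trace is a rank
    plus half a rank. A nonzero [c] is fixed by [P1], whose rank is then at least one. *)
Lemma tau_idem_bounds c : idem c -> 0 <= tau c /\ (c <> 0 -> 1 <= tau c).
Proof.
move=> cc; pose L := mulmx_of mul c.
pose P1 := 2 *: (L *m L) - L; pose Ph := 4 *: L - 4 *: (L *m L).
have P1E w : v2r w *m P1 = v2r (U c w).
  rewrite UopE // /P1 mulmxBr -scalemxAr mulmxA !(mulmx_ofE HA).
  by rewrite linearB linearZ.
have PhE w : v2r w *m Ph = v2r (Uhalf c w).
  rewrite /Ph mulmxBr -!scalemxAr mulmxA !(mulmx_ofE HA).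
  by rewrite /Uhalf linearB !linearZ.
have -> : tau c = \tr P1 + 2^-1 * \tr Ph.
  rewrite /P1 /Ph !mxtraceD !raddfN /= !mxtraceZ -/L -[tau c]/(\tr L).
  by lra.
rewrite !mxtrace_idempotent.
- split; first by rewrite addr_ge0 ?mulr_ge0 ?invr_ge0 ?ler0n.
  move=> c0; rewrite ler_wpDr ?mulr_ge0 ?invr_ge0 ?ler0n // ler1n lt0n mxrank_eq0.
  apply/eqP => P0; apply: c0; apply: v2r_inj.
  by rewrite -{1}(Uop_id cc cc) -P1E P0 mulmx0 linear0.
- by apply: mulmx_of_ext => w; rewrite mulmxA !PhE Uhalf_id.
- apply: mulmx_of_ext => w; rewrite mulmxA !P1E (Uop_id _ (jmul_Uop _ _)) //.
Qed.

Lemma tau_idem_ge0 c : idem c -> 0 <= tau c.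
Proof. by move=> /tau_idem_bounds[]. Qed.
Lemma tau_idem_ge1 c : idem c -> c <> 0 -> 1 <= tau c.
Proof. by move=> /tau_idem_bounds[]. Qed.
Lemma tau_idem_gt0 c : idem c -> c <> 0 -> 0 < tau c.
Proof. by move=> cc c0; apply: lt_le_trans ltr01 (tau_idem_ge1 cc c0). Qed.

Lemma tform_xx n (c : 'I_n -> A) (a : 'I_n -> R) : orth_system mul u c ->
  B (\sum_j a j *: c j) (\sum_j a j *: c j) = \sum_j a j ^+ 2 * tau (c j).
Proof.
move=> oc; rewrite (tform_sumr HA); apply: eq_bigr => i _.
by rewrite (tformZr HA) tform_orth_coef // mulrA expr2.
Qed.

Lemma tform_ge0 x : 0 <= B x x.
Proof.
have [n [a [c [oc -> _]]]] := spectral_poly HA x.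
rewrite tform_xx // sumr_ge0 // => i _; rewrite mulr_ge0 ?sqr_ge0 //.
by case: oc => cc _ _; exact: tau_idem_ge0.
Qed.

Lemma tform_eq0 x : B x x = 0 -> x = 0.
Proof.
have [n [a [c [oc -> _]]]] := spectral_poly HA x.
rewrite tform_xx // => /eqP; have [cc _ _] := oc.
rewrite psumr_eq0 => [/allP H|i _]; last by rewrite mulr_ge0 ?sqr_ge0 ?tau_idem_ge0.
apply: big1 => i _; have := H i (mem_index_enum _).
rewrite mulf_eq0 sqrf_eq0 => /orP[/eqP ->|/eqP t0]; first by rewrite scale0r.
have [->|/eqP c0] := eqVneq (c i) 0; first by rewrite scaler0.
by have := tau_idem_gt0 (cc i) c0; rewrite t0 ltxx.
Qed.

Lemma tform_CS x y : B x y ^+ 2 <= B x x * B y y.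
Proof.
have [y0|y0] := eqVneq (B y y) 0.
  by rewrite (tform_eq0 y0) !(tform0r HA) expr2 !mul0r mulr0.
have yp : 0 < B y y by rewrite lt_def y0 tform_ge0.
have := tform_ge0 (B y y *: x - B x y *: y).
rewrite !(tformE HA) (tformC HA y x).
rewrite (_ : _ + _ = B y y * (B x x * B y y - B x y ^+ 2)); last by ring.
by rewrite pmulr_rge0 // subr_ge0.
Qed.

(** The value is the squared norm of [U c x] plus half that of [Uhalf c x]. *)
Lemma tform_idem_ge0 c x : idem c -> 0 <= B (c ** x) x.
Proof.
move=> cc; have H1 : B (U c x) (U c x) = B x (U c x).
  by rewrite tform_Uop // (Uop_id cc (jmul_Uop _ cc)).
have H2 : B (Uhalf c x) (Uhalf c x) = B x (Uhalf c x) by rewrite tform_Uhalf Uhalf_id.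
have := (tform_ge0 (U c x), tform_ge0 (Uhalf c x)); rewrite H1 H2 UopE // /Uhalf !(tformE HA).
rewrite tformL => -[]; lra.
Qed.

(* Membership in the dual of the cone generated by the idempotents; it coincides
   with the cone of squares by [jleP]. *)
Definition pos x := forall c, idem c -> 0 <= B x c.

Lemma pos_sqr x : pos (x ** x).
Proof. by move=> c cc; rewrite (tform_assoc HA) (jmulC HA x c) (tformC HA) tform_idem_ge0. Qed.
Lemma pos_idem c : idem c -> pos c.
Proof. by move=> cc; rewrite -cc; exact: pos_sqr. Qed.
Lemma pos0 : pos 0. Proof. by move=> c _; rewrite (tform0l HA). Qed.
Lemma posD x y : pos x -> pos y -> pos (x + y).
Proof. by move=> px py c cc; rewrite (tformDl HA) addr_ge0 ?px ?py. Qed.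
Lemma posZ k x : 0 <= k -> pos x -> pos (k *: x).
Proof. by move=> k0 px c cc; rewrite (tformZl HA) mulr_ge0 ?px. Qed.
Lemma pos_sum I (r : seq I) (P : pred I) (F : I -> A) :
  (forall i, P i -> pos (F i)) -> pos (\sum_(i <- r | P i) F i).
Proof. by move=> H; elim/big_ind: _ => //; [exact: pos0 | exact: posD]. Qed.
(** Pairing with a nonzero spectral idempotent [c i] shows [a i >= 0], so square roots of the
    eigenvalues can be taken. *)
Lemma pos_ex_sqrt x : pos x -> exists y, x = y ** y.
Proof.
have [n [a [c [oc xE _]]]] := spectral_poly HA x => px; have [cc co _] := oc.
exists (\sum_i Num.sqrt (a i) *: c i).
rewrite (jmul_suml HA) xE; apply: eq_bigr => i _.
rewrite (jmulZl HA) orth_coef // scalerA -expr2.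
have [->|/eqP c0] := eqVneq (c i) 0; first by rewrite !scaler0.
rewrite sqr_sqrtr //; have := px _ (cc i).
by rewrite xE tform_orth_coef // pmulr_lge0 // tau_idem_gt0.
Qed.

Lemma jleP x y : jle mul x y <-> pos (y - x).
Proof. by split=> [[a ->]|/pos_ex_sqrt //]; exact: pos_sqr. Qed.

(** Cauchy-Schwarz bounds the pairing with [c] by [K] times the root of [tau c]; since [tau c >= 1]
    for nonzero [c], the root is at most [tau c]. *)
Lemma pos_norm K x : 0 <= K -> B x x <= K ^+ 2 -> pos (K *: u - x).
Proof.
move=> K0 xK c cc; rewrite !(tformE HA) (tformu HA) subr_ge0.
have [->|/eqP c0] := eqVneq c 0; first by rewrite (tform0r HA) (tau0 HA) mulr0.
have t1 := tau_idem_ge1 cc c0; have t0 := le_trans ler01 t1.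
apply: le_trans (ler_norm _) _; rewrite -(@ler_pXn2r _ 2) ?nnegrE ?mulr_ge0 //.
rewrite real_normK ?num_real //; apply: le_trans (tform_CS x c) _.
by rewrite (tform_idem cc) exprMn ler_pM ?tform_ge0 // expr2 ler_peMl.
Qed.

(** For a nonzero eigenvalue, [a i *: c i] equals [z ** c i], a polynomial in [z] without constant
    term. *)
Lemma spectral_A1 p z : idem p -> p ** z = z ->
  exists n (a : 'I_n -> R) (c : 'I_n -> A), [/\ orth_system mul u c,
     z = \sum_(i < n) a i *: c i & forall i, a i != 0 -> p ** c i = c i].
Proof.
move=> pp pz; have [n [a [c [oc zE cE]]]] := spectral_poly HA z.
exists n, a, c; split=> // i ai; apply: (scalerI ai); rewrite -(jmulZr HA).
have -> : a i *: c i = z ** c i by rewrite (jmulC HA) {1}zE orth_coef.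
by have [f ->] := cE i; rewrite -(evXmul HA); apply: (peirce1_ev HA).
Qed.

(** [U p] is self-adjoint and fixes the relevant spectral idempotents of [U p x], so each eigenvalue
    has the sign of a pairing of [x] with an idempotent. *)
Lemma pos_Uop p x : idem p -> pos x -> pos (U p x).
Proof.
move=> pp px; have [n [a [c [oc zE cE]]]] := spectral_A1 pp (jmul_Uop x pp).
have [cc _ _] := oc; rewrite zE; apply: pos_sum => i _.
have [->|a0] := eqVneq (a i) 0; first by rewrite scale0r; exact: pos0.
have [->|/eqP c0] := eqVneq (c i) 0; first by rewrite scaler0; exact: pos0.
apply: posZ; last exact: pos_idem.
rewrite -(pmulr_lge0 _ (tau_idem_gt0 (cc i) c0)) -tform_orth_coef // -zE tform_Uop //.
by rewrite (Uop_id pp (cE i a0)) px.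
Qed.

(** A spectral idempotent c in A_1(p) splits p as c + (p - c), so primitivity makes c equal to 0 or
    p. The linear form obtained can be tested in limits. *)
Lemma primitive_idempotentP p : primitive_idempotent mul p <->
  [/\ idem p, p <> 0 & forall v, p ** v = v -> exists k, v = k *: p].
Proof.
split=> [[pp p0 H]|[pp p0 H]]; split=> //.
  move=> v pv; have [n [a [c [[cc co _] vE cE]]]] := spectral_A1 pp pv.
  have cp i : a i != 0 -> exists k, c i = k *: p.
    move=> /cE pc; have [->|/eqP ci0] := eqVneq (c i) 0.
      by exists 0; rewrite scale0r.
    have [h|/eqP h] := eqVneq (p - c i) 0.
      by exists 1; rewrite scale1r; apply/esym/eqP; rewrite -subr_eq0 h.
    exfalso; apply: (H (c i) (p - c i)) => //; last by rewrite addrC subrK.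
    - rewrite /Defs.idempotent !(jmulE HA) pp pc (jmulC HA _ p) pc cc.
      by apply: vec_ext => f fD fZ fN f0; rewrite !(fD, fN); lra.
    - by rewrite (jmulBr HA) (jmulC HA _ p) pc cc subrr.
  rewrite vE; elim/big_ind: _ => [|x y [k ->] [l ->]|i _].
  - by exists 0; rewrite scale0r.
  - by exists (k + l); rewrite scalerDl.
  - have [->|/cp[k ->]] := eqVneq (a i) 0; first by exists 0; rewrite !scale0r.
    by exists (a i * k); rewrite scalerA.
move=> q1 q2 q11 q22 q12 q10 q20 pE.
have pq1 : p ** q1 = q1 by rewrite pE (jmulDl HA) q11 (jmulC HA) q12 addr0.
have [k kE] := H q1 pq1.
have /eqP : (k - 1) *: q1 = 0.
  by rewrite scalerBl scale1r -{1}pq1 -(jmulZl HA) -kE q11 subrr.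
rewrite scaler_eq0 subr_eq0 => /orP[/eqP k1|/eqP //].
by apply: q20; move/eqP: pE; rewrite kE k1 scale1r -subr_eq0 opprD addNKr oppr_eq0 => /eqP.
Qed.

End Cone.

(** * Existence of Jordan frames *)

Section Estimates.
Variables (R : realType) (A : vectType R) (mul : A -> A -> A) (u : A).
Hypothesis HA : formally_real_jordan mul u.
Local Notation "x ** y" := (mul x y) (at level 40, left associativity).
Implicit Types (x y z v w c e : A) (a b k : R).
Local Notation B := (tform mul).
Local Notation tau := (tau mul).
Local Notation U := (Uop mul).
Local Notation idem := (Defs.idempotent mul).
Local Notation pos := (pos mul).

Lemma frame_system n (p : 'I_n -> A) :
  jordan_frame mul u p -> orth_system mul u p /\ forall i, p i <> 0.
Proof.
case=> pp po ps; split; last by move=> i; have [] := pp i.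
by split=> // i; have [] := pp i.
Qed.

(** Each nonzero idempotent contributes at least 1 to [tau u]. This ends the refinement in
    [frame_exists] and leaves finitely many frame sizes. *)
Lemma system_size n (p : 'I_n -> A) :
  orth_system mul u p -> (forall i, p i <> 0) -> n%:R <= tau u.
Proof.
case=> pp po <- p0; rewrite -(tformu HA) (tform_sumr HA).
rewrite -[n in n%:R]card_ord -sum1_card natr_sum ler_sum // => i _.
by rewrite (tformu HA) (tau_idem_ge1 HA).
Qed.

(** [q1] replaces [p i] and [q2] enters at index 0, both with eigenvalue [lam i]. They lie in A_1(p
    i) and the other [p j] in A_0(p i), whence orthogonality by [peirce10]. *)
Lemma split_system n (p : 'I_n -> A) (lam : 'I_n -> R) i q1 q2 :
  orth_system mul u p -> (forall i, p i <> 0) ->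
  idem q1 -> idem q2 -> q1 ** q2 = 0 -> q1 <> 0 -> q2 <> 0 -> p i = q1 + q2 ->
  exists (p' : 'I_n.+1 -> A) (lam' : 'I_n.+1 -> R),
    [/\ orth_system mul u p', forall i, p' i <> 0 &
      \sum_j lam j *: p j = \sum_j lam' j *: p' j].
Proof.
move=> [pp po ps] p0 q11 q22 q12 q10 q20 piE.
pose p' (k : 'I_n.+1) := if unlift ord0 k is Some j then if j == i then q1 else p j else q2.
pose lam' (k : 'I_n.+1) := if unlift ord0 k is Some j then lam j else lam i.
have p'0 : p' ord0 = q2 by rewrite /p' unlift_none.
have p'S j : p' (lift ord0 j) = if j == i then q1 else p j by rewrite /p' liftK.
have eq1 : p i ** q1 = q1 by rewrite piE (jmulDl HA) q11 (jmulC HA) q12 addr0.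
have eq2 : p i ** q2 = q2 by rewrite piE (jmulDl HA) q22 q12 add0r.
have o1 j : j != i -> q1 ** p j = 0.
  by move=> ji; apply: (peirce10 HA (pp i)) => //; rewrite po // eq_sym.
have o2 j : j != i -> q2 ** p j = 0.
  by move=> ji; apply: (peirce10 HA (pp i)) => //; rewrite po // eq_sym.
exists p', lam'; split.
- split.
  + move=> k; case: (unliftP ord0 k) => [j|] ->; rewrite ?p'0 ?p'S //.
    by case: eqP => _ //; exact: pp.
  + move=> k l; case: (unliftP ord0 k) => [j|] ->; case: (unliftP ord0 l) => [j'|] ->;
      rewrite ?p'0 ?p'S ?eqxx //.
    * rewrite (inj_eq (@lift_inj _ _)) => jj'.
      have [ji|ji] := eqVneq j i; have [j'i|j'i] := eqVneq j' i.
      - by rewrite ji j'i eqxx in jj'.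
      - exact: o1.
      - by rewrite (jmulC HA) o1.
      - exact: po.
    * by move=> _; have [ji|ji] := eqVneq j i; rewrite // (jmulC HA) o2.
    * by move=> _; have [ji|ji] := eqVneq j' i; rewrite ?o2 // (jmulC HA).
  + rewrite big_ord_recl p'0; under eq_bigr do rewrite p'S.
    rewrite -[RHS]ps (bigD1 i) //= eqxx [RHS](bigD1 i) //= piE addrA (addrC q2).
    by congr (_ + _); apply: eq_bigr => j /negPf ->.
- move=> k; case: (unliftP ord0 k) => [j|] ->; rewrite ?p'0 ?p'S //.
  by case: eqP => // _; apply: p0.
- rewrite [RHS]big_ord_recl p'0.
  have -> : lam' ord0 = lam i by rewrite /lam' unlift_none.
  rewrite (bigD1 i) //= [X in _ = _ + X](bigD1 i) //= p'S eqxx {1}/lam' liftK.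
  rewrite piE scalerDr addrA (addrC (_ *: q2)); congr (_ + _); apply: eq_bigr => j ji.
  by rewrite p'S (negPf ji) /lam' liftK.
Qed.

(** Zero spectral idempotents are discarded, then non-primitive members are split in two until none
    is left; [system_size] bounds the number of splittings. *)
Lemma frame_exists x : exists n (p : 'I_n -> A) (lam : 'I_n -> R),
  spectral_dec mul u x p lam.
Proof.
have [n [a [c [[cc co cs] xE _]]]] := spectral_poly HA x.
pose S := [set i | c i != 0].
pose p (i : 'I_#|S|) := c (enum_val i); pose lam (i : 'I_#|S|) := a (enum_val i).
have sumE (F : 'I_n -> R) : \sum_i F i *: c i = \sum_(i < #|S|) F (enum_val i) *: p i.
  rewrite (bigID (mem S)) /= [X in _ + X]big1 ?addr0; last first.
    by move=> i; rewrite inE negbK => /eqP ->; rewrite scaler0.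
  by rewrite big_enum_val.
have op : orth_system mul u p.
  split=> [i|i j ij|]; first exact: cc.
    by apply: co; rewrite (inj_eq enum_val_inj).
  have := sumE (fun=> 1); under eq_bigr do rewrite scale1r.
  by under [in RHS]eq_bigr do rewrite scale1r; rewrite cs.
have p0 i : p i <> 0 by have := enum_valP i; rewrite inE => /eqP.
have xE' : x = \sum_i lam i *: p i by rewrite xE sumE.
have tu : 0 <= tau u by apply: (tau_idem_ge0 HA); apply: (idem_u HA).
have := archi_boundP tu; set N := Num.bound _ => {}tu.
move: #|S| p lam op p0 xE' {sumE} => m p lam.
move: {2}(N - m)%N (leqnn (N - m)%N) => d; elim: d => [|d IHd] in m p lam *;
  move=> md op p0 xE'.
  have := le_lt_trans (system_size op p0) tu; rewrite ltr_nat => h.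
  by move: md; rewrite leqn0 subn_eq0 leqNgt h.
apply: contrapT => nex; apply: (nex); exists m, p, lam; split=> //.
case: (op) => pp po ps; split=> // i; split=> // q1 q2 q11 q22 q12 q10 q20 pE.
apply: nex; have [p' [lam' [op' p'0 E]]] := split_system lam op p0 q11 q22 q12 q10 q20 pE.
by apply: (IHd m.+1 p' lam') => //; [rewrite subnS -ltnS; case: (N - m)%N md | rewrite -E].
Qed.

End Estimates.

(** * Largest eigenvalue and variation norm *)

Lemma ge0_of_perturb (R : realFieldType) (x k : R) :
  (forall eps, 0 < eps -> 0 <= x + eps * k) -> 0 <= x.
Proof.
move=> H; rewrite leNgt; apply/negP => x0.
have k1 : 0 < `|k| + 1 by rewrite ltr_wpDl.
have e0 : 0 < - x / (2 * (`|k| + 1)) by rewrite divr_gt0 ?oppr_gt0 ?mulr_gt0.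
have := H _ e0; apply/negP; rewrite -ltNge.
have : - x / (2 * (`|k| + 1)) * k <= - x / (2 * (`|k| + 1)) * (`|k| + 1).
  by rewrite ler_pM2l // (le_trans (ler_norm k)) // lerDl.
have -> : - x / (2 * (`|k| + 1)) * (`|k| + 1) = - x / 2 by field; rewrite ?gt_eqF.
lra.
Qed.

Lemma eq_by_le (R : realFieldType) (x y : R) : (forall l, x <= l <-> y <= l) -> x = y.
Proof. by move=> H; apply/eqP; rewrite eq_le; apply/andP; split; apply/H. Qed.

Section Gauge.
Variables (R : realType) (A : vectType R) (mul : A -> A -> A) (u : A).
Hypothesis HA : formally_real_jordan mul u.
Local Notation "x ** y" := (mul x y) (at level 40, left associativity).
Implicit Types (x y z v w c e : A) (a b k : R).
Local Notation B := (tform mul).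
Local Notation tau := (tau mul).
Local Notation U := (Uop mul).
Local Notation idem := (Defs.idempotent mul).
Local Notation pos := (pos mul).

Lemma pos_bound x : exists2 K, 0 <= K & B x x <= K ^+ 2.
Proof.
exists (B x x + 1); first by rewrite addr_ge0 // (tform_ge0 HA).
by have := tform_ge0 HA x; nra.
Qed.

(** The infimum is attained: pairing with [p] bounds the set below, [pos_norm] compressed by [U p]
    gives a member, and the inequalities of [pos] are closed in [l]. *)
Lemma Lam_le p z l : idem p -> p <> 0 -> p ** z = z ->
  (Lam mul p z <= l) <-> pos (l *: p - z).
Proof.
move=> pp p0 pz; have tp := tau_idem_gt0 HA pp p0.
pose S := [set l | jle mul z (l *: p)]%classic.
have lbS : lbound S (B z p / tau p).
  move=> m /(jleP HA)/(_ _ pp); rewrite (tformDl HA) (tformNl HA) (tformZl HA) (tform_idem pp).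
  by rewrite subr_ge0 ler_pdivrMr.
have hS : has_inf S.
  split; last by exists (B z p / tau p).
  have [K K0 zK] := pos_bound z; exists K; apply/(jleP HA).
  rewrite -{1}(Uop_id pp pz) -[in K *: _](Uop_id pp pp).
  have -> : U p p = U p u by rewrite /Uop pp !(jmul1r HA) pp.
  by rewrite -(UopZ HA) -(UopB HA); apply: (pos_Uop HA) => //; apply: (pos_norm HA).
split=> [le c cc|/(jleP HA) Sl]; last by apply: ge_inf => //; exists (B z p / tau p).
apply: (@ge0_of_perturb _ _ (B p c)) => eps e0.
have [m Sm ml] := inf_adherent e0 hS.
have := (jleP HA z (m *: p)).1 Sm c cc; rewrite !(tformE HA) => h.
have : (m - (l + eps)) * B p c <= 0.
  rewrite mulr_le0_ge0 ?(pos_idem HA pp cc) // subr_le0 (le_trans (ltW ml)) //.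
  by rewrite lerD2r.
lra.
Qed.

Definition lmax x := Lam mul u x.

Hypothesis u0 : u <> 0.

Lemma lmax_le x l : (lmax x <= l) <-> pos (l *: u - x).
Proof. by apply: Lam_le => //; [exact: (idem_u HA) | exact: (jmul1l HA)]. Qed.

Lemma lmax_pos x : pos (lmax x *: u - x). Proof. exact/lmax_le. Qed.

Lemma lmax_shift x k : lmax (x + k *: u) = lmax x + k.
Proof.
apply: eq_by_le => l; rewrite -lerBrDr !lmax_le scalerBl.
by rewrite opprD addrA addrAC.
Qed.

Lemma lmax_lip x y K : 0 <= K -> B (x - y) (x - y) <= K ^+ 2 -> lmax x <= lmax y + K.
Proof.
move=> K0 xy; apply/lmax_le.
have -> : (lmax y + K) *: u - x = (lmax y *: u - y) + (K *: u - (x - y)).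
  by apply: vec_ext => f fD fZ fN f0; rewrite !(fD, fN, fZ); lra.
by apply: (posD HA); [exact: lmax_pos | exact: (pos_norm HA)].
Qed.

Lemma pos_frame n (p : 'I_n -> A) (lam : 'I_n -> R) : orth_system mul u p ->
  (forall i, p i <> 0) -> pos (\sum_i lam i *: p i) <-> forall i, 0 <= lam i.
Proof.
move=> op p0; have [pp _ _] := op; split=> [H i|H].
  have := H (p i) (pp i); rewrite (tform_orth_coef HA) // pmulr_lge0 //.
  exact: (tau_idem_gt0 HA).
by apply: (pos_sum HA) => i _; apply: (posZ HA) => //; apply: (pos_idem HA).
Qed.

Lemma sum_sub_frame n (p : 'I_n -> A) (lam : 'I_n -> R) k : orth_system mul u p ->
  k *: u - \sum_i lam i *: p i = \sum_i (k - lam i) *: p i.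
Proof.
case=> _ _ <-; rewrite scaler_sumr -sumrB.
by apply: eq_bigr => i _; rewrite scalerBl.
Qed.

Lemma lmax_frame_le n (p : 'I_n -> A) (lam : 'I_n -> R) l : orth_system mul u p ->
  (forall i, p i <> 0) -> (lmax (\sum_i lam i *: p i) <= l) <-> forall i, lam i <= l.
Proof.
move=> op p0; rewrite lmax_le sum_sub_frame // pos_frame //.
by split=> H i; [rewrite -subr_ge0 | rewrite subr_ge0].
Qed.

Lemma lmax_frame_ex n (p : 'I_n -> A) (lam : 'I_n -> R) : orth_system mul u p ->
  (forall i, p i <> 0) -> exists i, lmax (\sum_i lam i *: p i) = lam i.
Proof.
case: n p lam => [|n] p lam op p0.
  by case: op => _ _; rewrite big_ord0 => /esym.
exists [arg max_(i > ord0) lam i]%O; case: arg_maxP => //= i _ H.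
by apply: eq_by_le => l; rewrite lmax_frame_le //; split=> // h j; apply: le_trans (H j isT) h.
Qed.

Lemma spectrum_bounds x l : spectrum mul u x l -> - lmax (- x) <= l <= lmax x.
Proof.
move=> [n [p [lam [[/frame_system[op p0] xE] [i <-]]]]].
have := (@lmax_frame_le n p lam (lmax x) op p0).1; rewrite -xE lexx => /(_ isT) -> //.
have xNE : - x = \sum_i (- lam i) *: p i.
  by rewrite xE -sumrN; apply: eq_bigr => j _; rewrite scaleNr.
have := (@lmax_frame_le n p (fun j => - lam j) (lmax (- x)) op p0).1; rewrite -xNE lexx.
by move=> /(_ isT i); rewrite andbT lerNl.
Qed.

Lemma spectrum_max x : spectrum mul u x (lmax x).
Proof.
have [n [p [lam [/[dup] jf /frame_system[op p0] xE]]]] := frame_exists HA x.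
exists n, p, lam; split=> //; rewrite xE.
by have [i ->] := lmax_frame_ex lam op p0; exists i.
Qed.

Lemma spectrumN x l : spectrum mul u x l -> spectrum mul u (- x) (- l).
Proof.
move=> [n [p [lam [[jf xE] [i <-]]]]]; exists n, p, (fun j => - lam j).
split; last by exists i.
split=> //; rewrite xE -sumrN.
by apply: eq_bigr => j _; rewrite scaleNr.
Qed.

(** [lmax] is the maximum of the spectrum, frames of every kind being allowed there; negation turns
    the infimum into a supremum. *)
Lemma varnormE w : varnorm mul u w = lmax w + lmax (- w).
Proof.
have supE x : sup (spectrum mul u x) = lmax x.
  have ubx : ubound (spectrum mul u x) (lmax x) by move=> l /spectrum_bounds/andP[].
  apply/eqP; rewrite eq_le; apply/andP; split.
    by apply: ge_sup => //; exists (lmax x); apply: spectrum_max.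
  by apply: ub_le_sup; [exists (lmax x) | exact: spectrum_max].
rewrite /varnorm supE; congr (_ + _).
rewrite /inf opprK -supE; congr sup; apply/seteqP; split=> l /=.
  by move=> [m /spectrumN h <-].
by move=> /spectrumN h; exists (- l); rewrite ?opprK // -[x in spectrum _ _ x]opprK.
Qed.

Lemma varnorm_ge0 w : 0 <= varnorm mul u w.
Proof.
rewrite varnormE; have /andP[h1 h2] := spectrum_bounds (spectrum_max w).
by rewrite -lerBlDr sub0r.
Qed.

Lemma gwE w v : gw mul u w v = lmax (v - w) + lmax (w - v) - lmax w - lmax (- w).
Proof. by rewrite /gw !varnormE opprB opprD !addrA. Qed.

Lemma gw_shiftl w v k : gw mul u (w + k *: u) v = gw mul u w v.
Proof.
rewrite !gwE !opprD !addrA -!scaleNr (addrAC w) !lmax_shift; lra.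
Qed.

(** Boundedness below separates these functions from those of [face_unbounded]. *)
Lemma gw_ge w v : - varnorm mul u w <= gw mul u w v.
Proof. by rewrite /gw lerDr varnorm_ge0. Qed.

(* The trace being a supremum over all decompositions, [k] is chosen as the
   supremum of the averages of the eigenvalues; no uniqueness of the trace is
   needed. *)
Lemma Tu_shift x : exists k, Tu mul u (x - k *: u).
Proof.
pose S := [set t | exists n (p : 'I_n -> A) (lam : 'I_n -> R),
   spectral_dec mul u x p lam /\ t = (\sum_(i < n) lam i) / n%:R]%classic.
have npos n (p : 'I_n -> A) : jordan_frame mul u p -> (0 < n)%N.
  by case: n p => // p [_ _]; rewrite big_ord0 => /esym.
have ubS : ubound S (lmax x).
  move=> t [n [p [lam [[/[dup] jf /frame_system[op p0] xE] ->]]]].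
  rewrite ler_pdivrMr ?ltr0n ?(npos _ _ jf) // mulr_natr.
  rewrite -[in _ *+ n](card_ord n) -sumr_const ler_sum // => i _.
  by have := (lmax_frame_le lam (lmax x) op p0).1; rewrite -xE; apply.
have hS : has_sup S.
  split; last by exists (lmax x).
  have [n [p [lam h]]] := frame_exists HA x.
  by exists ((\sum_(i < n) lam i) / n%:R), n, p, lam.
exists (sup S); rewrite /Tu /jtrace; set V := (X in sup X).
have shift n (p : 'I_n -> A) (lam : 'I_n -> R) k y : spectral_dec mul u y p lam ->
    spectral_dec mul u (y - k *: u) p (fun i => lam i - k).
  move=> [jf yE]; split=> //; have [[_ _ <-] _] := frame_system jf.
  rewrite yE scaler_sumr -sumrB.
  by apply: eq_bigr => i _; rewrite scalerBl.
(* Shifting a decomposition back gives one of [x], whose average is at most [sup S]. *)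
have ubV : ubound V 0.
  move=> t [n [p [lam [d ->]]]].
  have := shift _ _ _ (- sup S) _ d; rewrite scaleNr opprK subrK => {}d.
  have n0 : (0 : R) < n%:R by rewrite ltr0n; case: d => /npos.
  have : (\sum_(i < n) (lam i - - sup S)) / n%:R <= sup S.
    apply: ub_le_sup; first by exists (lmax x).
    by exists n, p, (fun i => lam i - - sup S).
  rewrite ler_pdivrMr // opprK big_split /= sumr_const card_ord mulr_natr.
  by rewrite gerDr.
apply/eqP; rewrite eq_le; apply/andP; split.
  apply: ge_sup => //; have [n [p [lam h]]] := frame_exists HA (x - sup S *: u).
  by exists (\sum_(i < n) lam i), n, p, lam.
(* An average within [eps] of [sup S] gives a sum above [- eps * n], and [n] is at most [tau u]. *)
apply: (@ge0_of_perturb _ _ (tau u)) => eps e0.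
have [t [n [p [lam [d ->]]]] lt] := sup_adherent e0 hS.
have n0 : (0 : R) < n%:R by rewrite ltr0n; case: d => /npos.
have : \sum_(i < n) (lam i - sup S) <= sup V.
  apply: ub_le_sup; first by exists 0.
  by exists n, p, (fun i => lam i - sup S); split=> //; apply: shift.
have nt : n%:R <= tau u by have [/frame_system[op p0] _] := d; apply: (system_size HA op).
rewrite ltr_pdivlMr // in lt.
rewrite big_split /= sumr_const card_ord mulNrn -mulr_natr.
have : eps * n%:R <= eps * tau u by rewrite ler_pM2l.
move: lt; rewrite mulrBl; lra.
Qed.

End Gauge.

(** * Approximation by faces *)

Section Sandwich.
Variables (R : realType) (A : vectType R) (mul : A -> A -> A) (u : A).
Hypothesis HA : formally_real_jordan mul u.
Hypothesis u0 : u <> 0.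
Local Notation "x ** y" := (mul x y) (at level 40, left associativity).
Implicit Types (x y z v w c e : A) (a b k : R).
Local Notation B := (tform mul).
Local Notation tau := (tau mul).
Local Notation U := (Uop mul).
Local Notation idem := (Defs.idempotent mul).
Local Notation pos := (pos mul).
Local Notation lmax := (lmax mul u).

Lemma eq_pos x y : x = y -> pos x -> pos y. Proof. by move=> ->. Qed.

Lemma tform_mulL p x : idem p ->
  B (p ** x) x = B (U p x) (U p x) + 2^-1 * B (Uhalf mul p x) (Uhalf mul p x).
Proof.
move=> pp; rewrite (tform_Uop HA _ _ pp) (Uop_id pp (jmul_Uop HA _ pp)).
rewrite (tform_Uhalf HA) (Uhalf_id HA _ pp) UopE // /Uhalf !(tformE HA) (tformL HA); lra.
Qed.

Lemma UhalfC p x : Uhalf mul (u - p) x = Uhalf mul p x.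
Proof.
rewrite /Uhalf !(jmulE HA) !(jmul1l HA).
by apply: vec_ext => f fD fZ fN f0; rewrite !(fD, fN, fZ); lra.
Qed.

(** Let P and Q be the pairings of [c] with [p] and [u - p]. By [tform_mulL] the left side is at
    most 2P and 2Q; for nonzero [c], P + Q = [tau c] is at least 1, so the larger of them is at
    least 1/2. *)
Lemma Uhalf_idem_norm p c : idem p -> idem c ->
  B (Uhalf mul p c) (Uhalf mul p c) <= 4 * (B p c * B (u - p) c).
Proof.
move=> pp cc; have qq := idemC HA pp.
have cE x : B (x ** c) c = B x c by rewrite (tform_assoc HA) cc.
have H1 := tform_mulL c pp; have H2 := tform_mulL c qq.
rewrite UhalfC !cE in H1 H2; set h := B (Uhalf _ _ _) _ in H1 H2 *.
have h0 : 0 <= h by apply: (tform_ge0 HA).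
have hP : h <= 2 * B p c by have := tform_ge0 HA (U p c); lra.
have hQ : h <= 2 * B (u - p) c by have := tform_ge0 HA (U (u - p) c); lra.
have [cz|/eqP c0] := eqVneq c 0.
  by move: hP; rewrite [in B p c]cz [in B (u - p) c]cz !(tform0r HA) mul0r !mulr0.
have : 1 <= B p c + B (u - p) c.
  by rewrite -(tformDl HA) addrC subrK (tformu HA) (tau_idem_ge1 HA).
move: (B p c) (B (u - p) c) hP hQ => P Q; nra.
Qed.

(** Cauchy-Schwarz and [Uhalf_idem_norm] bound the pairing with [c] by 2K times the root of PQ;
    weighted arithmetic-geometric means give KdP + (K/d)Q. *)
Lemma pos_Uhalf p v K d : idem p -> 0 <= K -> B v v <= K ^+ 2 -> 0 < d ->
  pos ((K * d) *: p + (K / d) *: (u - p) - Uhalf mul p v).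
Proof.
move=> pp K0 vK d0 c cc; rewrite (tformDl HA) (tformNl HA) (tform_Uhalf HA) subr_ge0.
rewrite (tformDl HA) !(tformZl HA).
have := Uhalf_idem_norm pp cc; have := tform_CS HA v (Uhalf mul p c).
have := pos_idem HA pp cc; have := pos_idem HA (idemC HA pp) cc.
have := tform_ge0 HA v; have := tform_ge0 HA (Uhalf mul p c).
move: (B v (Uhalf _ _ _)) (B (Uhalf _ _ _) _) (B v v) (B p c) (B _ c) vK.
move=> s h V P Q VK h0 V0 Q0 P0 sV hPQ.
apply: le_trans (ler_norm _) _; rewrite -(@ler_pXn2r _ 2) ?nnegrE //; last first.
  by rewrite addr_ge0 // mulr_ge0 ?divr_ge0 ?mulr_ge0 // ltW.
rewrite real_normK ?num_real //; apply: le_trans sV _.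
apply: (@le_trans _ _ (K ^+ 2 * (4 * (P * Q)))); first by rewrite ler_pM.
have -> : (K * d * P + K / d * Q) ^+ 2 = K ^+ 2 * (4 * (P * Q)) + (K * d * P - K / d * Q) ^+ 2.
  by field; rewrite gt_eqF.
by rewrite lerDl sqr_ge0.
Qed.

Lemma Uop_unit p : idem p -> U p u = p.
Proof. by move=> pp; rewrite /Uop (jmul1r HA) pp (jmul1r HA) mulr2n addrK. Qed.

Lemma pos_peirce_bound p v K d : idem p -> 0 <= K -> B v v <= K ^+ 2 -> 0 < d ->
  pos (U p v + (K * d) *: p + (K * (1 + d^-1)) *: (u - p) - v).
Proof.
move=> pp K0 vK d0; have qq := idemC HA pp.
have H1 := pos_Uhalf pp K0 vK d0.
have H2 : pos (K *: (u - p) - U (u - p) v).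
  have := pos_Uop HA qq (pos_norm HA K0 vK).
  by rewrite (UopB HA) (UopZ HA) Uop_unit.
have D := peirce_decomp HA v pp; apply: eq_pos (posD HA H1 H2).
by apply: vec_ext => f fD fZ fN f0; move: (congr1 f D); rewrite !(fD, fN, fZ); lra.
Qed.

Definition psum n (p : 'I_n -> A) (J : {set 'I_n}) := \sum_(i in J) p i.

(** One summand of a horofunction; the summand for [I] is taken at [- v]. *)
Definition face n (p : 'I_n -> A) (J : {set 'I_n}) (al : 'I_n -> R) v : R :=
  Lam mul (psum p J) (U (psum p J) v - \sum_(i in J) al i *: p i).

Lemma eq_face n (p : 'I_n -> A) (J : {set 'I_n}) (al al' : 'I_n -> R) v :
  (forall i, i \in J -> al i = al' i) -> face p J al v = face p J al' v.
Proof.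
by move=> H; rewrite /face; congr (Lam _ _ (_ - _)); apply: eq_bigr => i /H ->.
Qed.

Lemma psum_mul n (p : 'I_n -> A) (J : {set 'I_n}) i : orth_system mul u p ->
  psum p J ** p i = if i \in J then p i else 0.
Proof.
move=> [pp po _]; rewrite (jmul_suml HA); case: ifP => iJ.
  by rewrite (bigD1 i) //= pp big1 ?addr0 // => j /andP[_ ji]; rewrite po.
by apply: big1 => j jJ; rewrite po //; apply: contraTneq jJ => ->; rewrite iJ.
Qed.

Lemma psum_idem n (p : 'I_n -> A) (J : {set 'I_n}) : orth_system mul u p -> idem (psum p J).
Proof.
move=> op; rewrite /Defs.idempotent {2}/psum (jmul_sumr HA).
by apply: eq_bigr => i iJ; rewrite psum_mul // iJ.
Qed.

Lemma psum_mul_sum n (p : 'I_n -> A) (J : {set 'I_n}) (al : 'I_n -> R) : orth_system mul u p ->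
  psum p J ** (\sum_(i in J) al i *: p i) = \sum_(i in J) al i *: p i.
Proof.
move=> op; rewrite (jmul_sumr HA); apply: eq_bigr => i iJ.
by rewrite (jmulZr HA) psum_mul // iJ.
Qed.

Lemma psum_neq0 n (p : 'I_n -> A) (J : {set 'I_n}) j : orth_system mul u p ->
  j \in J -> p j <> 0 -> psum p J <> 0.
Proof. by move=> op jJ pj0 J0; apply: pj0; have := psum_mul J j op; rewrite jJ J0 (jmul0l HA). Qed.

Lemma psumC n (p : 'I_n -> A) (J : {set 'I_n}) : orth_system mul u p ->
  u - psum p J = \sum_(i | i \notin J) p i.
Proof. by case=> _ _ <-; rewrite (bigID (mem J)) /= /psum addrAC subrr add0r. Qed.

Lemma Uop_psum n (p : 'I_n -> A) (J : {set 'I_n}) (al : 'I_n -> R) : orth_system mul u p ->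
  U (psum p J) (\sum_i al i *: p i) = \sum_(i in J) al i *: p i.
Proof.
move=> op; have pp := psum_idem J op; rewrite (bigID (mem J)) /= (UopD HA).
rewrite Uop_id //; last exact: psum_mul_sum.
rewrite (Uop_orth HA) ?addr0 // (jmul_sumr HA) big1 // => i iJ.
by rewrite (jmulZr HA) psum_mul // (negPf iJ) scaler0.
Qed.

Lemma face_le n (p : 'I_n -> A) (J : {set 'I_n}) (al : 'I_n -> R) v j l :
  orth_system mul u p -> j \in J -> p j <> 0 ->
  (face p J al v <= l) <->
  pos (l *: psum p J - (U (psum p J) v - \sum_(i in J) al i *: p i)).
Proof.
move=> op jJ pj; apply: (Lam_le HA); [exact: psum_idem|exact: (psum_neq0 op jJ)|].
by rewrite (jmulBr HA) psum_mul_sum // (jmul_Uop HA) //; exact: psum_idem.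
Qed.

(* On the Peirce block of [J] the perturbation costs [K d]; off [J] the large
   coefficients [al i] absorb the remaining [K (1 + d^-1)]. *)
Lemma face_sandwich n (p : 'I_n -> A) (J : {set 'I_n}) (al : 'I_n -> R) v j K d :
  orth_system mul u p -> j \in J -> p j <> 0 -> al j = 0 ->
  0 <= K -> B v v <= K ^+ 2 -> 0 < d ->
  (forall i, i \notin J -> K * (1 + d^-1) + K <= al i) ->
  face p J al v <= lmax (v - \sum_i al i *: p i) <= face p J al v + K * d.
Proof.
move=> op jJ pj aj K0 vK d0 alK; have pJ := psum_idem J op.
have [pp po _] := op; apply/andP; split.
  (* Lower bound: [U (psum p J)] preserves positivity and maps [u] to [psum p J]. *)
  apply/(face_le _ _ _ op jJ pj).
  have := pos_Uop HA pJ (lmax_pos HA u0 (v - \sum_i al i *: p i)).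
  by rewrite !(UopB HA) Uop_psum // (UopZ HA) Uop_unit.
apply/(lmax_le HA u0); set L := face _ _ _ _.
have HL := (face_le al v L op jJ pj).1 (lexx _).
(* The face inequality is tested against [p j], where the coefficient is zero. *)
have LK : 0 <= L + K.
  have tj := tau_idem_gt0 HA (pp j) pj.
  rewrite -(pmulr_lge0 _ tj).
  have := pos_norm HA K0 (_ : B (- v) (- v) <= K ^+ 2) (pp j).
  rewrite !(tformE HA) opprK => /(_ vK); rewrite (tformu HA); have := HL _ (pp j).
  rewrite (tformDl HA) (tformZl HA) (tformNl HA) (tformDl HA (U _ _)) (tformNl HA).
  have -> : B (psum p J) (p j) = tau (p j) by rewrite {1}/tform psum_mul // jJ.
  rewrite (tform_Uop HA _ _ pJ) Uop_id //; last by rewrite psum_mul // jJ.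
  have -> : B (\sum_(i in J) al i *: p i) (p j) = 0.
    rewrite (tform_suml HA) big1 // => i iJ; rewrite (tformZl HA).
    have [->|ij] := eqVneq i j; first by rewrite aj mul0r.
    by rewrite /tform po // (tau0 HA) mulr0.
  lra.
have H2 := pos_peirce_bound pJ K0 vK d0.
(* The hypothesis on [al i] leaves each coefficient at least [L + K + K * d]. *)
have H3 : pos (\sum_(i | i \notin J) (L + K * d - K * (1 + d^-1) + al i) *: p i).
  apply: (pos_sum HA) => i iJ; apply: (posZ HA); last exact: (pos_idem HA).
  have := alK i iJ; have : 0 <= K * d by rewrite mulr_ge0 // ltW.
  lra.
apply: eq_pos (posD HA (posD HA HL H2) H3).
have -> : \sum_(i | i \notin J) (L + K * d - K * (1 + d^-1) + al i) *: p i =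
   (L + K * d - K * (1 + d^-1)) *: (u - psum p J) + \sum_(i | i \notin J) al i *: p i.
  by rewrite psumC // scaler_sumr -big_split; apply: eq_bigr => i _; rewrite scalerDl.
rewrite [\sum_i al i *: p i](bigID (mem J)) /=.
by apply: vec_ext => f fD fZ fN f0; rewrite !(fD, fN, fZ); lra.
Qed.

End Sandwich.

(** * Geodesic rays and Busemann points *)

Section Rays.
Variables (R : realType) (A : vectType R) (mul : A -> A -> A) (u : A).
Hypothesis HA : formally_real_jordan mul u.
Hypothesis u0 : u <> 0.
Local Notation "x ** y" := (mul x y) (at level 40, left associativity).
Implicit Types (x y z v w c e : A) (a b k : R).
Local Notation B := (tform mul).
Local Notation tau := (tau mul).
Local Notation U := (Uop mul).
Local Notation pos := (pos mul).
Local Notation lmax := (lmax mul u).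
Local Notation face := (face mul).

Lemma lmax_frame_eq n (p : 'I_n -> A) (lam : 'I_n -> R) M : orth_system mul u p ->
  (forall i, p i <> 0) -> (exists i, lam i = M) -> (forall i, lam i <= M) ->
  lmax (\sum_i lam i *: p i) = M.
Proof.
move=> op p0 [i <-] H; apply: eq_by_le => l; rewrite (lmax_frame_le HA u0) //.
by split=> // h j; apply: le_trans (H j) h.
Qed.

Lemma sumN n (p : 'I_n -> A) (lam : 'I_n -> R) :
  - (\sum_i lam i *: p i) = \sum_i (- lam i) *: p i.
Proof. by rewrite -sumrN; apply: eq_bigr => i _; rewrite scaleNr. Qed.

(** The constants [lmax w] and [lmax (- w)] are absorbed as multiples of [u]; for a frame, both
    coefficient families then have minimum 0. *)
Lemma gw_frame n (p : 'I_n -> A) (lam : 'I_n -> R) v : orth_system mul u p ->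
  gw mul u (\sum_i lam i *: p i) v =
  lmax (- v - \sum_i (lmax (\sum_i lam i *: p i) - lam i) *: p i) +
  lmax (v - \sum_i (lam i + lmax (- \sum_i lam i *: p i)) *: p i).
Proof.
move=> op; rewrite (gwE HA u0); set w := \sum_i _; rewrite -(sum_sub_frame _ _ op) -/w.
have -> : \sum_i (lam i + lmax (- w)) *: p i = w + lmax (- w) *: u.
  case: op => _ _ <-; rewrite scaler_sumr -big_split.
  by apply: eq_bigr => i _; rewrite scalerDl.
have -> : - v - (lmax w *: u - w) = (w - v) + (- lmax w) *: u.
  by apply: vec_ext => f fD fZ fN f0; rewrite !(fD, fN, fZ); lra.
rewrite opprD addrA -scaleNr !(lmax_shift HA u0); lra.
Qed.

Lemma varnorm_shift w k : varnorm mul u (w + k *: u) = varnorm mul u w.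
Proof. rewrite !(varnormE HA u0) opprD -scaleNr !(lmax_shift HA u0); lra. Qed.

Section Face.
Variables (n : nat) (p : 'I_n -> A) (I J : {set 'I_n}) (al : 'I_n -> R).
Hypothesis jf : jordan_frame mul u p.
Hypothesis dIJ : [disjoint I & J].
Variables (i0 j0 : 'I_n).
Hypotheses (Ii0 : i0 \in I) (Jj0 : j0 \in J) (ai0 : al i0 = 0) (aj0 : al j0 = 0).
Hypotheses (aI : forall i, i \in I -> 0 <= al i) (aJ : forall i, i \in J -> 0 <= al i).

Let op : orth_system mul u p. Proof. exact: (frame_system jf).1. Qed.
Let p0 : forall i, p i <> 0. Proof. exact: (frame_system jf).2. Qed.

(* For [t >= 0] large, the smallest eigenvalues [al j - t / 2] of the ray sit on [J]
   and the largest ones [t / 2 - al i] on [I]. *)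
Definition ray_coef t i : R :=
  if i \in I then t / 2 - al i else if i \in J then al i - t / 2 else 0.
Definition ray t : A := \sum_i ray_coef t i *: p i.

Let alS := \sum_i `|al i|.
Let al_le i : `|al i| <= alS.
Proof. by rewrite /alS (bigD1 i) //= lerDl sumr_ge0. Qed.
Let JnI j : j \in J -> (j \in I) = false.
Proof. by move=> jJ; apply/negbTE; move: dIJ; rewrite disjoint_sym => /disjointFr ->. Qed.

Lemma ray_norm t s : s <= t -> varnorm mul u (ray t - ray s) = t - s.
Proof.
move=> st; have -> : ray t - ray s = \sum_i (ray_coef t i - ray_coef s i) *: p i.
  by rewrite -sumrB; apply: eq_bigr => i _; rewrite scalerBl.
rewrite (varnormE HA u0) sumN !(@lmax_frame_eq _ _ _ ((t - s) / 2)) //; first by lra.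
- by exists j0; rewrite /ray_coef JnI // Jj0; lra.
- by move=> i; rewrite /ray_coef; case: ifP => _; [|case: ifP => _]; lra.
- by exists i0; rewrite /ray_coef Ii0; lra.
- by move=> i; rewrite /ray_coef; case: ifP => _; [|case: ifP => _]; lra.
Qed.

Lemma gw_ray v eps : 0 < eps -> exists N, forall t, N <= t ->
  `|gw mul u (ray t) v - (face p I al (- v) + face p J al v)| < eps.
Proof.
move=> e0; have [K K0 vK] := pos_bound HA v.
(* The two sandwich errors [K * d] then add up to less than [eps]. *)
pose d := eps / (2 * K + 1); have d0 : 0 < d by rewrite divr_gt0 //; lra.
pose C := K * (1 + d^-1) + K.
have C0 : 0 <= C by rewrite addr_ge0 // mulr_ge0 // addr_ge0 // invr_ge0 ltW.
have S0 : 0 <= alS by apply: le_trans (al_le i0).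
have alI i := le_trans (ler_norm (al i)) (al_le i).
(* From here on the extreme eigenvalues are [t / 2], attained at [i0], and [- t / 2], attained at
   [j0]; the coefficients off each face are at least [C]. *)
exists (2 * C + alS) => t Nt.
have mxP : lmax (ray t) = t / 2.
  apply: lmax_frame_eq => //; first by exists i0; rewrite /ray_coef Ii0 ai0 subr0.
  move=> i; rewrite /ray_coef; have := alI i.
  by case: ifP => [/aI|_]; [|case: ifP => [/aJ|_]]; lra.
have mxN : lmax (- ray t) = t / 2.
  rewrite sumN; apply: lmax_frame_eq => //.
    by exists j0; rewrite /ray_coef JnI // Jj0 aj0; lra.
  move=> i; rewrite /ray_coef; have := alI i.
  by case: ifP => [/aI|_]; [|case: ifP => [/aJ|_]]; lra.
have vNK : B (- v) (- v) <= K ^+ 2 by rewrite !(tformE HA) opprK.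
rewrite /ray gw_frame // -/(ray t) mxP mxN.
have bI i : i \notin I -> C <= t / 2 - ray_coef t i.
  by move=> iI; rewrite /ray_coef (negPf iI); have := alI i; case: ifP => _; lra.
have bJ i : i \notin J -> C <= ray_coef t i + t / 2.
  by move=> iJ; rewrite /ray_coef (negPf iJ); have := alI i; case: ifP => _; lra.
have zI : t / 2 - ray_coef t i0 = 0 by rewrite /ray_coef Ii0 ai0; lra.
have zJ : ray_coef t j0 + t / 2 = 0 by rewrite /ray_coef JnI // Jj0 aj0; lra.
have := face_sandwich HA u0 op Ii0 (@p0 i0) zI K0 vNK d0 bI.
rewrite (@eq_face _ _ _ _ p I _ al); last by move=> i iI; rewrite /ray_coef iI; lra.
move=> /andP[H1 H2].
have := face_sandwich HA u0 op Jj0 (@p0 j0) zJ K0 vK d0 bJ.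
rewrite (@eq_face _ _ _ _ p J _ al); last by move=> i iJ; rewrite /ray_coef JnI // iJ; lra.
move=> /andP[H3 H4].
have KE : 2 * (K * d) < eps.
  rewrite /d !mulrA ltr_pdivrMr; last by lra.
  by have := mulr_ge0 (ltW e0) K0; lra.
by rewrite ltr_norml; apply/andP; split; lra.
Qed.

Variable g : A -> R.
Hypothesis gE : forall v, Tu mul u v -> g v = face p I al (- v) + face p J al v.

(** Take eigenvalue [s] on [I] and [- s] on [J]. As [al] is nonnegative there, the face terms are at
    most [- s + k] and [- s - k], and the correction [k] to trace zero cancels. *)
Lemma face_unbounded s : exists2 v, Tu mul u v & g v <= - 2 * s.
Proof.
pose mu i : R := if i \in I then s else if i \in J then - s else 0.
have [k Tv] := Tu_shift HA u0 (\sum_i mu i *: p i).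
set v := _ - _ in Tv; exists v => //; rewrite gE //.
have UI : U (psum p I) v = (s - k) *: psum p I.
  rewrite /v (UopB HA) (Uop_psum HA _ _ op) (UopZ HA) (Uop_unit HA (psum_idem HA I op)).
  rewrite scalerBl; congr (_ - _); rewrite scaler_sumr; apply: eq_bigr => i iI.
  by rewrite /mu iI.
have UJ : U (psum p J) v = (- s - k) *: psum p J.
  rewrite /v (UopB HA) (Uop_psum HA _ _ op) (UopZ HA) (Uop_unit HA (psum_idem HA J op)).
  rewrite scalerBl; congr (_ - _); rewrite scaler_sumr; apply: eq_bigr => i iJ.
  by rewrite /mu JnI // iJ.
have posS (S : {set 'I_n}) : (forall i, i \in S -> 0 <= al i) -> pos (\sum_(i in S) al i *: p i).
  move=> aS; apply: (pos_sum HA) => i /aS a0; apply: (posZ HA) => //.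
  by have [pp _ _] := op; exact: (pos_idem HA (pp i)).
have H1 : face p I al (- v) <= - s + k.
  apply/(face_le HA _ _ _ op Ii0 (@p0 i0)); rewrite (UopN HA) UI -scaleNr opprB.
  by rewrite opprB addrCA -scalerBl (_ : - s + k - (k - s) = 0) ?scale0r ?addr0; [apply: posS|lra].
have H2 : face p J al v <= - s - k.
  apply/(face_le HA _ _ _ op Jj0 (@p0 j0)); rewrite UJ.
  by rewrite opprB addrCA subrr addr0; apply: posS.
lra.
Qed.

(** Moves the ray into T_u along [u], changing neither [gw] nor distances. *)
Let shift t := projT1 (cid (Tu_shift HA u0 (ray t))).
Let TuShift t : Tu mul u (ray t - shift t *: u) := projT2 (cid (Tu_shift HA u0 (ray t))).

Lemma face_busemann : busemann_point mul u g.
Proof.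
pose gam t := ray t - shift t *: u.
have gamE t v : gw mul u (gam t) v = gw mul u (ray t) v.
  by rewrite /gam -scaleNr (gw_shiftl HA u0).
have lim v eps : Tu mul u v -> 0 < eps ->
    exists N, forall t, N <= t -> `|gw mul u (gam t) v - g v| < eps.
  move=> Tv e0; have [N HN] := gw_ray v e0.
  by exists N => t /HN; rewrite gamE gE.
split; [split|].
- move=> F FT eps e0.
  have [N HN] : exists N, forall v, v \in F -> forall t, N <= t ->
      `|gw mul u (gam t) v - g v| < eps.
    elim: F FT => [|v F IHF] FT; first by exists 0.
    have [|N1 HN1] := IHF; first by move=> w wF; apply: FT; rewrite inE wF orbT.
    have [N2 HN2] := lim v eps (FT v (mem_head _ _)) e0.
    exists (Num.max N1 N2) => w; rewrite inE => /orP[/eqP ->|wF] t;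
      rewrite ge_max => /andP[h1 h2]; [exact: HN2 | exact: HN1].
  by exists (gam N); split=> [|v vF]; [exact: TuShift | exact: HN].
(* This value of [s] undercuts the lower bound of [gw_ge] by 2. *)
- move=> [w [Tw gw_]]; have [v Tv] := face_unbounded (varnorm mul u w / 2 + 1).
  rewrite gw_ //; have := gw_ge HA u0 w v; lra.
- exists [set t | 0 <= t]%classic, gam; split; last first.
    by move=> v Tv eps e0; have [N HN] := lim v eps Tv e0; exists N => t _; apply: HN.
  split=> //=.
  + move=> M; exists (Num.max 0 M); rewrite ?le_max ?lexx ?orbT //.
  + by move=> t _; exact: TuShift.
  + move=> eps e0; exists 0 => t s t0 s0 _ st.
    (* The ray is an exact geodesic, so the defect is zero. *)
    have H a b : b <= a -> varnorm mul u (gam a - gam b) = a - b.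
      move=> ba; rewrite -(ray_norm ba) -[RHS](varnorm_shift _ (shift b - shift a)).
      by congr varnorm; apply: vec_ext => f fD fZ fN f0; rewrite !(fD, fN, fZ); lra.
    by rewrite !H // subr0 subrK subrr normr0.
Qed.

End Face.
End Rays.

(** * Limits along an ultrafilter *)

(** Otherwise the finitely many complements would belong to [F], and with them their
    intersection. *)
Lemma ultra_fin (W : Type) (T : finType) (F : set_system W) (P : T -> W -> Prop) :
  UltraFilter F -> F (fun w => exists t, P t w) -> exists t, F (P t).
Proof.
move=> FU FP; apply: contrapT => /forallNP nF.
have : F (fun w => forall t, ~ P t w).
  by apply: filter_forall => t; have [/nF|] := in_ultra_setVsetC (P t) FU.
by move=> /(filterI FP)/filter_ex[w [[t Pt] /(_ t)]].
Qed.

Section RealLimits.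
Variables (R : realType) (W : Type) (F : set_system W).
Hypothesis FU : UltraFilter F.
Implicit Types f h : W -> R.

Definition rlim f (l : R) := forall eps, 0 < eps -> F (fun w => `|f w - l| < eps).

Lemma rlimP f l : rlim f l <-> (f @ F --> l)%classic.
Proof. by rewrite cvgrPdistC_lt. Qed.

Lemma rlim_unique f l m : rlim f l -> rlim f m -> l = m.
Proof. by move=> /rlimP fl /rlimP fm; apply: cvg_unique fl fm. Qed.

Lemma rlim_cst l : rlim (fun=> l) l. Proof. by apply/rlimP; apply: cvg_cst. Qed.

Lemma rlimD f h l m : rlim f l -> rlim h m -> rlim (fun w => f w + h w) (l + m).
Proof. by move=> /rlimP fl /rlimP hm; apply/rlimP; apply: cvgD. Qed.

Lemma rlimM f h l m : rlim f l -> rlim h m -> rlim (fun w => f w * h w) (l * m).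
Proof. by move=> /rlimP fl /rlimP hm; apply/rlimP; apply: cvgM. Qed.

Lemma rlimN f l : rlim f l -> rlim (fun w => - f w) (- l).
Proof. by move=> /rlimP fl; apply/rlimP; apply: cvgN. Qed.

Lemma rlimB f h l m : rlim f l -> rlim h m -> rlim (fun w => f w - h w) (l - m).
Proof. by move=> fl /rlimN; apply: rlimD. Qed.

Lemma rlim_sum I (r : seq I) (f : I -> W -> R) (l : I -> R) :
  (forall i, rlim (f i) (l i)) -> rlim (fun w => \sum_(i <- r) f i w) (\sum_(i <- r) l i).
Proof.
move=> H; elim: r => [|i r IHr].
  by rewrite big_nil; under eq_fun do rewrite big_nil; exact: rlim_cst.
by rewrite big_cons; under eq_fun do rewrite big_cons; exact: rlimD.
Qed.

Lemma eq_rlim f h l : F (fun w => f w = h w) -> rlim f l -> rlim h l.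
Proof.
by move=> fh fl eps e0; apply: (filterS2 _ _ fh (fl eps e0)) => w /= ->.
Qed.

Lemma rlim_ge f l a : rlim f l -> F (fun w => a <= f w) -> a <= l.
Proof.
move=> fl af; rewrite leNgt; apply/negP => la.
have la0 : 0 < a - l by rewrite subr_gt0.
have [w [/= h1]] := filter_ex (filterI af (fl _ la0)).
by rewrite ltr_norml => /andP[_]; lra.
Qed.

(** Compactness gives a cluster point, to which an ultrafilter converges. *)
Lemma rlim_bounded f C : F (fun w => `|f w| <= C) -> exists l, rlim f l.
Proof.
move=> FC; have PF := @ultra_proper _ _ FU.
have FC' : (f @ F)%classic (`[- C, C]%classic).
  rewrite /fmap /=; apply: (filterS _ FC) => w /=; rewrite ler_norml in_itv /=; exact.
have [l [_ cl]] := @segment_compact R (- C) C (f @ F)%classic _ FC'.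
exists l => eps e0; have [//|nF] := in_ultra_setVsetC (fun w => `|f w - l| < eps) FU.
have [y [ny]] := cl (fun y => ~ (`|y - l| < eps)) (ball l eps) nF (nbhsx_ballx _ _ e0).
by rewrite /ball /= distrC.
Qed.

Lemma rlim_or_infty f : F (fun w => 0 <= f w) ->
  (exists l, rlim f l) \/ forall C, F (fun w => C <= f w).
Proof.
move=> f0; have [H|/existsNP[C nC]] := pselect (forall C, F (fun w => C <= f w)); first by right.
left; apply: (@rlim_bounded _ `|C|).
have [//|nF] := in_ultra_setVsetC (fun w => C <= f w) FU.
apply: (filterS2 _ _ f0 nF) => w /= fw /negP; rewrite -ltNge => fC.
by rewrite ger0_norm // (le_trans (ltW fC)) // ler_norm.
Qed.

End RealLimits.

Section VectorLimits.
Variables (R : realType) (A : vectType R) (mul : A -> A -> A) (u : A).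
Hypothesis HA : formally_real_jordan mul u.
Local Notation "x ** y" := (mul x y) (at level 40, left associativity).
Local Notation B := (tform mul).
Local Notation tau := (tau mul).

(** The Gram matrix of a basis is invertible, the form being definite. Weak limits thereby reduce to
    finitely many real ones. *)
Lemma dual_basis : exists (N : nat) (b d : 'I_N -> A),
  forall x, x = \sum_j B x (b j) *: d j.
Proof.
pose b (j : 'I_(dim A)) : A := r2v (delta_mx 0 j).
pose G : 'M[R]_(dim A) := \matrix_(i, j) B (b i) (b j).
have xb x : x = \sum_j v2r x 0 j *: b j.
  rewrite -{1}[x]v2rK {1}[v2r x]row_sum_delta linear_sum.
  by apply: eq_bigr => i _; rewrite linearZ.
have BG x j : B x (b j) = (v2r x *m G) 0 j.
  rewrite mxE {1}[x]xb (tform_suml HA).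
  by apply: eq_bigr => i _; rewrite (tformZl HA) mxE.
have uG : G \in unitmx.
  rewrite -row_free_unit; apply: inj_row_free => v vG.
  apply: (can_inj r2vK); rewrite linear0; apply: (tform_eq0 HA).
  rewrite {2}[r2v v]xb (tform_sumr HA) big1 // => j _.
  by rewrite (tformZr HA) BG r2vK vG mxE mulr0.
exists _, b, (fun j => r2v (row j (invmx G))) => x.
rewrite -{1}[x]v2rK -[v2r x](mulmxK uG) mulmx_sum_row linear_sum.
by apply: eq_bigr => j _; rewrite linearZ BG.
Qed.

Variables (W : Type) (F : set_system W).
Hypothesis FU : UltraFilter F.

(* Weak convergence for the trace form. *)
Definition vlim (x : W -> A) (l : A) := forall d, rlim F (fun w => B (x w) d) (B l d).

Lemma vlim_unique x y l m : vlim x l -> vlim y m -> F (fun w => x w = y w) -> l = m.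
Proof.
move=> xl ym xy; apply/eqP; rewrite -subr_eq0; apply/eqP; apply: (tform_eq0 HA).
rewrite {1}(tformDl HA) (tformNl HA); apply/eqP; rewrite subr_eq0; apply/eqP.
apply: (rlim_unique FU (xl _)); apply: eq_rlim (ym _).
by apply: filterS xy => w ->.
Qed.

Lemma vlim_cst l : vlim (fun=> l) l.
Proof. by move=> d; apply: rlim_cst. Qed.

Lemma vlimD x y l m : vlim x l -> vlim y m -> vlim (fun w => x w + y w) (l + m).
Proof.
move=> xl ym d; rewrite (tformDl HA); under eq_fun do rewrite (tformDl HA).
exact: rlimD.
Qed.

Lemma vlimZ (a : W -> R) k x l : rlim F a k -> vlim x l -> vlim (fun w => a w *: x w) (k *: l).
Proof.
move=> ak xl d; rewrite (tformZl HA); under eq_fun do rewrite (tformZl HA).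
exact: rlimM.
Qed.

Lemma vlimN x l : vlim x l -> vlim (fun w => - x w) (- l).
Proof.
by move=> xl d; rewrite (tformNl HA); under eq_fun do rewrite (tformNl HA); apply: rlimN.
Qed.

Lemma vlim_sum I (r : seq I) (x : I -> W -> A) (l : I -> A) :
  (forall i, vlim (x i) (l i)) -> vlim (fun w => \sum_(i <- r) x i w) (\sum_(i <- r) l i).
Proof.
move=> H d; rewrite (tform_suml HA); under eq_fun do rewrite (tform_suml HA).
by apply: rlim_sum => i; apply: H.
Qed.

Lemma vlimM x y l m : vlim x l -> vlim y m -> vlim (fun w => x w ** y w) (l ** m).
Proof.
have [N [b [d bd]]] := dual_basis; move=> xl ym e.
have E z t : B (z ** t) e = \sum_j \sum_k B z (b j) * B t (b k) * B (d j ** d k) e.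
  rewrite {1}[z]bd {1}[t]bd (jmul_suml HA) (tform_suml HA); apply: eq_bigr => j _.
  rewrite (jmul_sumr HA) (tform_suml HA); apply: eq_bigr => k _.
  by rewrite (jmulZl HA) (jmulZr HA) !(tformZl HA) mulrA.
rewrite E; under eq_fun do rewrite E.
do 2! apply: rlim_sum => ?.
apply: rlimM; last exact: rlim_cst.
by apply: rlimM; [exact: xl | exact: ym].
Qed.

Lemma vlim_bounded x C : F (fun w => B (x w) (x w) <= C) -> exists l, vlim x l.
Proof.
have [N [b [d bd]]] := dual_basis => xC.
have /choice[l Hl] : forall j, exists l, rlim F (fun w => B (x w) (b j)) l.
  move=> j; apply: (@rlim_bounded _ _ _ FU _ (C * B (b j) (b j) + 1)).
  apply: filterS xC => w xw; have := tform_CS HA (x w) (b j).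
  have : B (x w) (x w) * B (b j) (b j) <= C * B (b j) (b j).
    by rewrite ler_wpM2r // (tform_ge0 HA).
  move: (B (x w) (b j)) (C * _) => s D h1 h2.
  have : s ^+ 2 <= D by apply: le_trans h2 h1.
  by rewrite ler_norml => ?; apply/andP; split; nra.
exists (\sum_j l j *: d j) => e; rewrite (tform_suml HA).
have E w : B (x w) e = \sum_j B (x w) (b j) * B (d j) e.
  by rewrite {1}[x w]bd (tform_suml HA); apply: eq_bigr => j _; rewrite (tformZl HA).
under eq_fun do rewrite E; apply: rlim_sum => j; rewrite (tformZl HA).
by apply: rlimM => //; apply: rlim_cst.
Qed.

(** In dual bases the squared distance is a finite sum of products of coordinates tending to 0. *)
Lemma vlim_norm x l : vlim x l -> rlim F (fun w => B (x w - l) (x w - l)) 0.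
Proof.
have [N [b [d bd]]] := dual_basis => xl.
have E w : B (x w - l) (x w - l) = \sum_j (B (x w) (b j) - B l (b j)) * (B (x w) (d j) - B l (d j)).
  rewrite {2}[x w - l]bd (tform_sumr HA); apply: eq_bigr => j _.
  by rewrite (tformZr HA) !(tformDl HA) !(tformNl HA).
under eq_fun do rewrite E.
have Z : \sum_(j < N) (B l (b j) - B l (b j)) * (B l (d j) - B l (d j)) = 0.
  by rewrite big1 // => j _; rewrite subrr mul0r.
refine (eq_ind _ (rlim F _) _ _ Z).
apply: (rlim_sum FU) => j; apply: (rlimM FU); apply: (rlimB FU);
  by [exact: xl | exact: rlim_cst].
Qed.

Hypothesis u0 : u <> 0.

Lemma lmax_lim x l : vlim x l -> rlim F (fun w => lmax mul u (x w)) (lmax mul u l).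
Proof.
move=> /vlim_norm xl eps e0; have e2 : 0 < eps / 2 by lra.
have := xl ((eps / 2) ^+ 2); rewrite exprn_gt0 // => /(_ isT).
apply: filterS => w; rewrite subr0 ger0_norm ?(tform_ge0 HA) // => /ltW h.
have h' : B (l - x w) (l - x w) <= (eps / 2) ^+ 2.
  by rewrite -[l - x w]opprB (tformNl HA) (tformNr HA) opprK.
have := lmax_lip HA u0 (ltW e2) h; have := lmax_lip HA u0 (ltW e2) h'.
move=> h1 h2.
by rewrite ltr_norml; apply/andP; split; lra.
Qed.

End VectorLimits.

(** * Horofunctions as limits of faces *)

Section Limits.
Variables (R : realType) (A : vectType R) (mul : A -> A -> A) (u : A).
Hypothesis HA : formally_real_jordan mul u.
Hypothesis u0 : u <> 0.
Local Notation "x ** y" := (mul x y) (at level 40, left associativity).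
Local Notation B := (tform mul).
Local Notation tau := (tau mul).
Local Notation lmax := (lmax mul u).
Local Notation U := (Uop mul).

Section Along.
Variables (W : Type) (F : set_system W).
Hypothesis FU : UltraFilter F.
Local Notation vlim := (vlim mul F).

(** Continuity of [lmax] cannot reach diverging coefficients, so those off [J] are replaced by a
    constant [T]. Three sandwiches, uniform in the frame, and one limit each cost at most
    [eps / 4]. *)
Lemma face_lim n (p : W -> 'I_n -> A) (al : W -> 'I_n -> R) (q : 'I_n -> A)
    (aL : 'I_n -> R) (J : {set 'I_n}) v j :
  F (fun w => orth_system mul u (p w) /\ forall i, p w i <> 0) ->
  orth_system mul u q -> (forall i, q i <> 0) ->
  (forall i, vlim (fun w => p w i) (q i)) ->
  (forall i, i \in J -> rlim F (fun w => al w i) (aL i)) ->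
  (forall i, i \notin J -> forall C, F (fun w => C <= al w i)) ->
  j \in J -> F (fun w => al w j = 0) ->
  rlim F (fun w => lmax (v - \sum_i al w i *: p w i)) (face mul q J aL v).
Proof.
move=> Fp oq q0 pq alJ alnJ jJ al0 eps e0.
have aLj : aL j = 0.
  apply: (rlim_unique FU (alJ j jJ)); apply: eq_rlim (rlim_cst FU 0).
  by apply: filterS al0 => w ->.
have [K K0 vK] := pos_bound HA v.
pose d := eps / (4 * (K + 1)); have d0 : 0 < d by rewrite divr_gt0 //; lra.
have Kd : K * d < eps / 4.
  rewrite /d mulrA ltr_pdivrMr; last by lra.
  by have := mulr_ge0 (ltW e0) K0; lra.
(* The threshold that [face_sandwich] demands off [J]. *)
pose T := K * (1 + d^-1) + K.
pose alN w i := if i \in J then al w i else T.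
pose aN i := if i \in J then aL i else T.
have hN : rlim F (fun w => lmax (v - \sum_i alN w i *: p w i)) (lmax (v - \sum_i aN i *: q i)).
  apply: (lmax_lim HA FU u0); apply: (vlimD HA FU); first exact: vlim_cst.
  apply: (vlimN HA FU); apply: (vlim_sum HA FU) => i; apply: (vlimZ HA FU) => //.
  rewrite /alN /aN; case: ifP => iJ; [exact: alJ | exact: rlim_cst].
have big : F (fun w => forall i, i \notin J -> T <= al w i).
  apply: filter_forall => i; have [iJ|iJ] := boolP (i \in J).
    by apply: filterE.
  by apply: filterS (alnJ i iJ T).
have e4 : 0 < eps / 4 by lra.
apply: filterS (filterI (filterI Fp al0) (filterI big (hN _ e4))).
move=> w [[[op p0] aj] [alT]]; set h1 := lmax (_ - \sum_i alN w i *: _).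
have /andP[] := face_sandwich HA u0 op jJ (p0 j) aj K0 vK d0 alT.
have ajN : alN w j = 0 by rewrite /alN jJ.
have alTN i : i \notin J -> T <= alN w i by rewrite /alN => /negPf ->.
have /andP[] := face_sandwich HA u0 op jJ (p0 j) ajN K0 vK d0 alTN.
have aLN : aN j = 0 by rewrite /aN jJ.
have aTN i : i \notin J -> T <= aN i by rewrite /aN => /negPf ->.
have /andP[] := face_sandwich HA u0 oq jJ (q0 j) aLN K0 vK d0 aTN.
rewrite -/h1 (@eq_face _ _ _ _ (p w) _ (alN w) (al w)); last by move=> i iJ; rewrite /alN iJ.
rewrite (@eq_face _ _ _ _ q _ aN aL); last by move=> i iJ; rewrite /aN iJ.
rewrite !ltr_norml => ? ? ? ? ? ? /andP[? ?]; apply/andP; split; lra.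
Qed.

(* A closed condition in [p], which makes primitivity pass to the limit. *)
Lemma primitive_eqn p v : primitive_idempotent mul p -> tau p *: U p v = B v p *: p.
Proof.
move=> /(primitive_idempotentP HA)[pp _ pA].
have [k kE] := pA _ (jmul_Uop HA v pp).
have -> : B v p = k * tau p.
  by rewrite -{1}(Uop_id pp pp) -(tform_Uop HA _ _ pp) kE (tformZl HA) (tform_idem pp).
by rewrite kE scalerA mulrC.
Qed.

(** The algebraic equations are closed conditions, [tau (q i) >= 1] prevents collapse to zero, and
    the limit of [primitive_eqn] makes A_1(q i) a line. *)
Lemma vlim_frame n (p : W -> 'I_n -> A) (q : 'I_n -> A) :
  F (fun w => jordan_frame mul u (p w)) ->
  (forall i, vlim (fun w => p w i) (q i)) -> jordan_frame mul u q.
Proof.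
move=> Fp pq; have qq i : q i ** q i = q i.
  apply: (vlim_unique HA FU (vlimM HA FU (pq i) (pq i)) (pq i)).
  by apply: filterS Fp => w /frame_system[[pp _ _] _]; apply: pp.
have tq i : 1 <= tau (q i).
  rewrite -(tformu HA) (tformC HA); apply: (rlim_ge FU (pq i u)).
  apply: filterS Fp => w /frame_system[[pp _ _] p0].
  by rewrite (tformC HA) (tformu HA); apply: (tau_idem_ge1 HA (pp i)).
split.
- move=> i; apply/(primitive_idempotentP HA); split; first exact: qq.
    by move=> q0; have := tq i; rewrite q0 (tau0 HA) ler10.
  move=> v qv; exists ((tau (q i))^-1 * B v (q i)).
  have t0 : tau (q i) != 0 by rewrite gt_eqF // (lt_le_trans ltr01).
  apply: (scalerI t0); rewrite scalerA mulrA divff // mul1r.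
  have {1}-> : v = U (q i) v by rewrite Uop_id.
  have tl : rlim F (fun w => tau (p w i)) (tau (q i)).
    rewrite -(tformu HA) (tformC HA); apply: eq_rlim (pq i u).
    by apply: filterE => w; rewrite (tformC HA) (tformu HA).
  have bl : rlim F (fun w => B v (p w i)) (B v (q i)).
    rewrite (tformC HA); apply: eq_rlim (pq i v).
    by apply: filterE => w; rewrite (tformC HA).
  have Ul : vlim (fun w => U (p w i) v) (U (q i) v).
    rewrite /Uop mulr2n; under eq_fun do rewrite mulr2n.
    have cv := vlim_cst mul FU v; have h1 := vlimM HA FU (pq i) (vlimM HA FU (pq i) cv).
    have h2 := vlimM HA FU (vlimM HA FU (pq i) (pq i)) cv.
    exact: (vlimD HA FU (vlimD HA FU h1 h1) (vlimN HA FU h2)).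
  apply: (vlim_unique HA FU (vlimZ HA FU tl Ul) (vlimZ HA FU bl (pq i))).
  by apply: filterS Fp => w [pp _ _]; apply: primitive_eqn.
- move=> i j ij.
  apply: (vlim_unique HA FU (vlimM HA FU (pq i) (pq j)) (vlim_cst mul FU 0)).
  by apply: filterS Fp => w [_ po _]; apply: po.
- apply: (vlim_unique HA FU (vlim_sum HA FU _ pq) (vlim_cst mul FU u)).
  by apply: filterS Fp => w [_ _ ps].
Qed.

Lemma frames_cluster n (p : W -> 'I_n -> A) :
  F (fun w => jordan_frame mul u (p w)) ->
  exists q : 'I_n -> A, forall i, vlim (fun w => p w i) (q i).
Proof.
move=> Fp; have /choice[q Hq] : forall i, exists l, vlim (fun w => p w i) l.
  move=> i; apply: (vlim_bounded HA FU (C := tau u)).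
  apply: filterS Fp => w /frame_system[[pp _ ps] _]; rewrite (tform_idem (pp i)).
  have -> : tau u = \sum_j tau (p w j).
    rewrite -{1}ps -(tformu HA) (tform_sumr HA).
    by apply: eq_bigr => j _; rewrite (tformu HA).
  by rewrite (bigD1 i) //= lerDl sumr_ge0 // => j _; rewrite (tau_idem_ge0 HA (pp j)).
by exists q.
Qed.

End Along.

(** The sets of [w] approximating [g] on a finite set within [eps] generate a proper filter, which
    extends to an ultrafilter. *)
Lemma closure_ultrafilter g : in_pointwise_closure mul u g ->
  exists F : set_system A, UltraFilter F /\
    forall v, Tu mul u v -> rlim F (fun w => gw mul u w v) (g v).
Proof.
move=> cl.
pose D := [set s : seq A * R | (forall v, v \in s.1 -> Tu mul u v) /\ 0 < s.2]%classic.
pose X (s : seq A * R) := [set w | forall v, v \in s.1 -> `|gw mul u w v - g v| < s.2]%classic.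
have PF : ProperFilter (filter_from D X).
  apply: filter_from_proper; first apply: filter_from_filter.
  - by exists ([::], 1); split.
  - move=> [s1 e1] [s2 e2] [/= T1 e10] [/= T2 e20].
    exists (s1 ++ s2, Num.min e1 e2).
      by split=> [v|] /=; rewrite ?mem_cat ?lt_min ?e10 // => /orP[/T1|/T2].
    move=> w H; split=> v vs; have := H v; rewrite /= mem_cat vs ?orbT => /(_ isT);
      by rewrite lt_min => /andP[].
  - move=> [s e] [/= Ts e0]; have [w [_ H]] := cl s Ts e e0; by exists w.
have [F [FU sF]] := ultraFilterLemma PF; exists F; split=> // v Tv eps e0.
apply: sF; exists ([:: v], eps); first by split=> // w; rewrite inE => /eqP ->.
by move=> w /(_ v (mem_head _ _)).
Qed.

Lemma horofunction_face g : horofunction mul u g ->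
  exists (n : nat) (p : 'I_n -> A) (I J : {set 'I_n}) (al : 'I_n -> R) (i0 j0 : 'I_n),
    [/\ jordan_frame mul u p, [disjoint I & J],
      [/\ i0 \in I, al i0 = 0 & forall i, i \in I -> 0 <= al i],
      [/\ j0 \in J, al j0 = 0 & forall j, j \in J -> 0 <= al j] &
      forall v, Tu mul u v -> g v = face mul p I al (- v) + face mul p J al v].
Proof.
move=> [/closure_ultrafilter[F [FU gF]] ng].
have tu : 0 <= tau u by apply: (tau_idem_ge0 HA); apply: (idem_u HA).
have := archi_boundP tu; set N := Num.bound _ => {}tu.
(* Frame sizes are bounded by [tau u], so the ultrafilter selects one size [n]. *)
have [n Fn] : exists n : 'I_N, F (fun w => exists pl : ('I_n -> A) * ('I_n -> R),
    spectral_dec mul u w pl.1 pl.2).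
  apply: (ultra_fin FU); apply: filterE => w.
  have [m [p [lam d]]] := frame_exists HA w.
  have mN : (m < N)%N.
    rewrite -(ltr_nat R); apply: le_lt_trans tu; have [jf _] := d.
    by have [op p0] := frame_system jf; apply: (system_size HA op).
  by exists (Ordinal mN), (p, lam).
(* Where no decomposition of size [n] exists the default is zero; such [w] are negligible along
   [F]. *)
have /choice[pl Hpl] : forall w, exists pl : ('I_n -> A) * ('I_n -> R),
    (exists pl : ('I_n -> A) * ('I_n -> R), spectral_dec mul u w pl.1 pl.2) ->
    spectral_dec mul u w pl.1 pl.2.
  move=> w; have [[pl H]|nH] := pselect (exists pl : ('I_n -> A) * ('I_n -> R),
    spectral_dec mul u w pl.1 pl.2); first by exists pl.
  by exists (fun=> 0, fun=> 0).
have {Hpl Fn}Fd : F (fun w => spectral_dec mul u w (pl w).1 (pl w).2).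
  by apply: filterS Fn => w /Hpl.
pose p w := (pl w).1; pose lam w := (pl w).2.
(* Heights above the least and below the largest eigenvalue; they sum to the spread [V w]. *)
pose al w i := lam w i + lmax (- w); pose be w i := lmax w - lam w i.
pose V w := lmax w + lmax (- w).
have Fjf : F (fun w => jordan_frame mul u (p w)) by apply: filterS Fd => w [].
have Fop : F (fun w => orth_system mul u (p w) /\ forall i, p w i <> 0).
  by apply: filterS Fjf => w /frame_system.
have bnd w i : spectral_dec mul u w (p w) (lam w) -> 0 <= al w i /\ 0 <= be w i.
  move=> d; have : spectrum mul u w (lam w i) by exists n, (p w), (lam w); split=> //; exists i.
  by move=> /(spectrum_bounds HA u0)/andP[h1 h2]; rewrite /al /be; split; lra.
have al_ge0 i : F (fun w => 0 <= al w i) by apply: filterS Fd => w /bnd -/(_ i)[].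
have be_ge0 i : F (fun w => 0 <= be w i) by apply: filterS Fd => w /bnd -/(_ i)[].
have alV i : F (fun w => al w i <= V w).
  by apply: filterS Fd => w /bnd -/(_ i)[]; rewrite /al /be /V; lra.
have alE w : spectral_dec mul u w (p w) (lam w) ->
    \sum_i al w i *: p w i = w + lmax (- w) *: u.
  move=> [/frame_system[[_ _ us] _] wE]; have -> : lmax (- w) *: u = \sum_i lmax (- w) *: p w i.
    by rewrite -scaler_sumr us.
  rewrite [X in _ = X + _]wE -big_split.
  by apply: eq_bigr => i _; rewrite scalerDl.
have [j0 Fj0] : exists j, F (fun w => al w j = 0).
  apply: (ultra_fin FU); apply: filterS Fd => w d.
  have [/frame_system[op p0] wE] := d.
  have [j jE] := lmax_frame_ex HA u0 (fun i => - lam w i) op p0.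
  have wN : - w = \sum_i (- lam w i) *: p w i by rewrite [in LHS]wE sumN.
  by exists j; rewrite /al wN jE addrN.
have [i0 Fi0] : exists i, F (fun w => be w i = 0).
  apply: (ultra_fin FU); apply: filterS Fd => w d.
  have [/frame_system[op p0] wE] := d.
  have [j jE] := lmax_frame_ex HA u0 (lam w) op p0.
  have mw : lmax w = lam w j by rewrite [in LHS]wE.
  by exists j; rewrite /be mw subrr.
have [q pq] := frames_cluster FU Fjf.
have qf := vlim_frame FU Fjf pq; have [oq q0] := frame_system qf.
have [[l Vl]|Vinf] : (exists l, rlim F V l) \/ forall C, F (fun w => C <= V w).
- apply: (rlim_or_infty FU); apply: filterE => w.
  by rewrite /V -(varnormE HA u0) (varnorm_ge0 HA u0).
(* With convergent spread every coefficient converges, and [g] is [gw] at the limit element, moved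
   into T_u. *)
- exfalso; apply: ng.
  have /choice[aL HaL] : forall i, exists a, rlim F (fun w => al w i) a.
    move=> i; apply: (rlim_bounded FU (C := l + 1)).
    apply: filterS (filterI (filterI (al_ge0 i) (alV i)) (Vl 1 ltr01)) => w [[h1 h2]].
    by rewrite ltr_norml ger0_norm // => /andP[_]; lra.
  pose x w := \sum_i al w i *: p w i; pose xl := \sum_i aL i *: q i.
  have xlim : vlim mul F x xl by apply: (vlim_sum HA FU) => i; apply: (vlimZ HA FU).
  have gx v : rlim F (fun w => gw mul u w v) (gw mul u xl v).
    have H : rlim F (fun w => gw mul u (x w) v) (gw mul u xl v).
      rewrite (gwE HA u0); under eq_fun do rewrite (gwE HA u0).
      have cv := vlim_cst mul FU v; have xN := vlimN HA FU xlim.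
      have vN := vlimN HA FU cv.
      apply: (rlimB FU); last exact: (lmax_lim HA FU u0 xN).
      apply: (rlimB FU); last exact: (lmax_lim HA FU u0 xlim).
      apply: (rlimD FU); apply: (lmax_lim HA FU u0).
        exact: (vlimD HA FU cv xN).
      exact: (vlimD HA FU xlim vN).
    by apply: eq_rlim H; apply: filterS Fd => w d; rewrite /x (alE w d) (gw_shiftl HA u0).
  have [k Tk] := Tu_shift HA u0 xl; exists (xl - k *: u); split=> // v Tv.
  by rewrite -scaleNr (gw_shiftl HA u0); apply: (rlim_unique FU (gF v Tv) (gx v)).
(* [J] collects the indices of convergent coefficients; by [rlim_or_infty] the others tend to
   infinity. *)
have lim_set (a : A -> 'I_n -> R) : (forall i, F (fun w => 0 <= a w i)) ->
    exists (J : {set 'I_n}) (aL : 'I_n -> R),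
    (forall i, i \in J -> rlim F (fun w => a w i) (aL i)) /\
    (forall i, i \notin J -> forall C, F (fun w => C <= a w i)).
  move=> a0; pose J := [set i | `[< exists l, rlim F (fun w => a w i) l >]].
  have /choice[aL HaL] : forall i, exists l, i \in J -> rlim F (fun w => a w i) l.
    move=> i; case: (boolP (i \in J)) => [|_]; last by exists 0.
    by rewrite inE => /asboolP[l ?]; exists l.
  exists J, aL; split=> // i; rewrite inE => /asboolPn nl.
  by have [|//] := rlim_or_infty FU (a0 i).
have [J [aL [aJ anJ]]] := lim_set al al_ge0.
have [I [bL [bI bnI]]] := lim_set be be_ge0.
have mem0 (a : A -> 'I_n -> R) (S : {set 'I_n}) i :
    (forall i, i \notin S -> forall C, F (fun w => C <= a w i)) ->
    F (fun w => a w i = 0) -> i \in S.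
  move=> aS ai; apply/negPn/negP => /aS/(_ 1) h1.
  by have [w [/= -> ]] := filter_ex (filterI ai h1); rewrite ler10.
have lim0 (a : A -> 'I_n -> R) i l : rlim F (fun w => a w i) l ->
    F (fun w => a w i = 0) -> l = 0.
  move=> al_ a0; apply: (rlim_unique FU al_); apply: eq_rlim (rlim_cst FU 0).
  by apply: filterS a0 => w ->.
have Jj0 := mem0 _ _ _ anJ Fj0; have Ii0 := mem0 _ _ _ bnI Fi0.
(* At a common index both heights would converge, and so would their sum [V], which tends to
   infinity. *)
have dIJ : [disjoint I & J].
  apply/pred0Pn => -[i /andP[/= iI iJ]].
  have VL : rlim F V (aL i + bL i).
    apply: eq_rlim (rlimD FU (aJ i iJ) (bI i iI)).
    by apply: filterE => w; rewrite /al /be /V; lra.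
  have [w [/= h1]] := filter_ex (filterI (Vinf (aL i + bL i + 1)) (VL 1 ltr01)).
  by rewrite ltr_norml => /andP[_]; lra.
have JnI j : j \in J -> (j \in I) = false.
  by move=> jJ; apply/negbTE; move: dIJ; rewrite disjoint_sym => /disjointFr ->.
pose alpha i := if i \in I then bL i else aL i.
exists n, q, I, J, alpha, i0, j0; split=> //.
- split=> [//||i iI]; first by rewrite /alpha Ii0 (lim0 be i0 _ (bI _ Ii0)).
  by rewrite /alpha iI; apply: (rlim_ge FU (bI i iI)).
- split=> [//||i iJ]; first by rewrite /alpha JnI // (lim0 al j0 _ (aJ _ Jj0)).
  by rewrite /alpha JnI //; apply: (rlim_ge FU (aJ i iJ)).
move=> v Tv; apply: (rlim_unique FU (gF v Tv)).
rewrite (@eq_face _ _ _ _ q I alpha bL); last by move=> i iI; rewrite /alpha iI.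
rewrite (@eq_face _ _ _ _ q J alpha aL); last by move=> i iJ; rewrite /alpha JnI.
apply: eq_rlim (rlimD FU (face_lim FU (- v) Fop oq q0 pq bI bnI Ii0 Fi0)
                         (face_lim FU v Fop oq q0 pq aJ anJ Jj0 Fj0)).
apply: filterS Fd => w [/frame_system[op p0] wE].
by rewrite [in RHS]wE (gw_frame HA u0) // -wE.
Qed.

End Limits.

(** * The zero algebra and the classification *)

Lemma trivial_algebra (R : realType) (A : vectType R) (mul : A -> A -> A) (u : A) :
  formally_real_jordan mul u -> u = 0 -> forall x : A, x = 0.
Proof. by move=> HA u0 x; rewrite -(jmul1l HA x) u0 (jmul0l HA). Qed.

(** All functions [gw w] coincide, so a limit of them is one of them. The closure condition for the
    empty list supplies a point of T_u. *)
Lemma trivial_no_horofunction (R : realType) (A : vectType R) (mul : A -> A -> A) (u : A)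
    (g : A -> R) : (forall x : A, x = 0) -> ~ horofunction mul u g.
Proof.
move=> A0 [cl]; apply.
have [w [Tw _]] := cl [::] (fun v => ltac:(by [])) 1 ltr01.
exists w; split=> // v Tv; apply/eqP; rewrite -subr_eq0 -normr_eq0; apply/eqP/le_anti.
rewrite normr_ge0 andbT; apply/ler_addgt0Pr => eps e0; rewrite add0r.
have [|w' [_ H]] := cl [:: v] _ eps e0; first by move=> v'; rewrite inE => /eqP ->.
by have := ltW (H v (mem_head _ _)); rewrite (A0 w') (A0 w) distrC.
Qed.

Theorem theorem5p3 (R : realType) (A : vectType R) (mul : A -> A -> A) (u : A)
  (HA : formally_real_jordan mul u) :
  (forall g : A -> R,
     horofunction mul u g <->
     exists (n : nat) (p : 'I_n -> A) (I J : {set 'I_n}) (alpha : 'I_n -> R),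
       jordan_frame mul u p /\
       [disjoint I & J] /\ I != set0 /\ J != set0 /\
       ((exists2 i, i \in I & alpha i = 0) /\ (forall i, i \in I -> 0 <= alpha i)) /\
       ((exists2 j, j \in J & alpha j = 0) /\ (forall j, j \in J -> 0 <= alpha j)) /\
           (forall v, Tu mul u v ->
             g v = Lam mul (\sum_(i in I) p i)
                       (- Uop mul (\sum_(i in I) p i) v - \sum_(i in I) alpha i *: p i)
                 + Lam mul (\sum_(j in J) p j)
                       (Uop mul (\sum_(j in J) p j) v - \sum_(j in J) alpha j *: p j)))
  /\ (forall g : A -> R, horofunction mul u g -> busemann_point mul u g).
Proof.
have faceN n (p : 'I_n -> A) (I : {set 'I_n}) (al : 'I_n -> R) v :
    face mul p I al (- v) = Lam mul (\sum_(i in I) p i)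
      (- Uop mul (\sum_(i in I) p i) v - \sum_(i in I) al i *: p i).
  by rewrite /face (UopN HA).
(* In the zero algebra neither side holds: an index in [I] would give a nonzero idempotent. *)
have [u0|/eqP u0] := eqVneq u 0.
  have A0 := trivial_algebra HA u0; have nh g := @trivial_no_horofunction _ _ mul u g A0.
  split=> g; last by move=> /nh.
  split=> [/nh //|[n [p [I [J [al [[pp _ _] [_ [_ [_ [[[i _ _] _] _]]]]]]]]]]].
  by have [_ /(_ (A0 _))] := pp i.
split=> g.
  split=> [/(horofunction_face HA u0)|].
    move=> [n [p [I [J [al [i0 [j0 [jf dIJ [Ii0 ai0 aI] [Jj0 aj0 aJ] gE]]]]]]]].
    exists n, p, I, J, al; do !split => //.
    - by apply/set0Pn; exists i0.
    - by apply/set0Pn; exists j0.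
    - by exists i0.
    - by exists j0.
    - by move=> v /gE ->; rewrite faceN.
  move=> [n [p [I [J [al [jf [dIJ [_ [_ [[[i0 Ii0 ai0] aI] [[[j0 Jj0 aj0] aJ] gE]]]]]]]]]]].
  have [] // := face_busemann HA u0 jf dIJ Ii0 Jj0 ai0 aj0 aI aJ (g := g).
  by move=> v /gE ->; rewrite faceN.
move=> /(horofunction_face HA u0)[n [p [I [J [al [i0 [j0 [jf dIJ [Ii0 ai0 aI] [Jj0 aj0 aJ] gE]]]]]]]].
exact: (face_busemann HA u0 jf dIJ Ii0 Jj0 ai0 aj0 aI aJ gE).
Qed.
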